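(* We have $\mathbf{BPC}\vdash\,\Rightarrow(\Theta^*_n)^t$ (for all $n\ge1$), and the number of lines of any proof of this sequent in $\mathbf{BPC}$ is exponential in $n$.
   Context: **Convention.** ''Exponential in $n$'' means bounded below by $2^{n^{\Omega(1)}}$, i.e. there is $\varepsilon>0$ such that the quantity is at least $2^{n^{\varepsilon}}$ for all sufficiently large $n$. A line of a proof is a sequent occurring in it; proofs may be dag-like. **The calculus $\mathbf{BPC}$** (Visser's basic propositional calculus) over $\{\wedge,\vee,\to,\top,\bot\}$. Sequents $\Upsilon\Rightarrow\Xi$ with $\Upsilon,\Xi$ finite multisets of formulas. Initial sequents: $\Upsilon,\phi\Rightarrow\phi,\Xi$; $\Upsilon\Rightarrow\top,\Xi$; $\Upsilon,\bot\Rightarrow\Xi$. Rules (premises / conclusion): $(L\wedge)$ $\phi,\psi,\Upsilon\Rightarrow\Xi$ / $\phi\wedge\psi,\Upsilon\Rightarrow\Xi$; $(R\wedge)$ $\Upsilon\Rightarrow\Xi,\phi$ and $\Upsilon\Rightarrow\Xi,\psi$ / $\Upsilon\Rightarrow\Xi,\phi\wedge\psi$; $(L\vee)$ $\phi,\Upsilon\Rightarrow\Xi$ and $\psi,\Upsilon\Rightarrow\Xi$ / $\phi\vee\psi,\Upsilon\Rightarrow\Xi$; $(R\vee)$ $\Upsilon\Rightarrow\Xi,\phi,\psi$ / $\Upsilon\Rightarrow\Xi,\phi\vee\psi$; $(R\to)$ $\phi,\Upsilon\Rightarrow\psi$ / $\Upsilon\Rightarrow\Xi,\phi\to\psi$;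 $(D)$ $\phi\wedge\psi,\Upsilon\Rightarrow\Xi$ and $\phi\wedge\theta,\Upsilon\Rightarrow\Xi$ / $\phi\wedge(\psi\vee\theta),\Upsilon\Rightarrow\Xi$; $(Tr)$ $\Upsilon\Rightarrow\phi\to\psi$ and $\Upsilon\Rightarrow\psi\to\theta$ / $\Upsilon\Rightarrow\Xi,\phi\to\theta$; $(F\wedge)$ $\Upsilon\Rightarrow\phi\to\psi$ and $\Upsilon\Rightarrow\phi\to\theta$ / $\Upsilon\Rightarrow\Xi,\phi\to(\psi\wedge\theta)$; $(F\vee)$ $\Upsilon\Rightarrow\phi\to\theta$ and $\Upsilon\Rightarrow\psi\to\theta$ / $\Upsilon\Rightarrow\Xi,(\phi\vee\psi)\to\theta$; (cut) $\Upsilon_1\Rightarrow\phi,\Xi_1$ and $\Upsilon_2,\phi\Rightarrow\Xi_2$ / $\Upsilon_1,\Upsilon_2\Rightarrow\Xi_1,\Xi_2$. **Translation $t$** from formulas over $\{\wedge,\vee,*,\setminus,/,1,0\}$ to formulas over $\{\wedge,\vee,\to,\top,\bot\}$: $p^t=p$, $0^t=\bot$, $1^t=\top$, $(\phi\circ\psi)^t=\phi^t\circ\psi^t$ for $\circ\in\{\wedge,\vee\}$, $(\phi*\psi)^t=\phi^t\wedge\psi^t$, $(\psi/\phi)^t=(\phi\setminus\psi)^t=\phi^t\to\psi^t$. **The formulas.** For $1\le k\le n$ use variables $p_{i,j},q_{i,j}$ ($0\le i,j<n$), $s_{i,l},s'_{i,l}$ ($0\le i<n$, $0\le l<k$), $r_{i,l},r'_{i,l}$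 ($0\le i<n$, $0\le l<k+1$), and put $$\alpha^k_n(\bar p,\bar s,\bar s'):=\bigvee_{i<n}\bigwedge_{l<k}s'_{i,l}\ \vee\bigvee_{i,j<n}\bigvee_{l<k}(s_{i,l}\wedge s_{j,l}\wedge p_{i,j}),$$ $$\beta^{k+1}_n(\bar q,\bar r,\bar r'):=\bigvee_{l<k+1}\bigwedge_{i<n}r'_{i,l}\ \vee\bigvee_{i,j<n}\bigvee_{l<m<k+1}(r_{i,l}\wedge r_{j,m}\wedge q_{i,j}).$$ With $\bigotimes$ denoting iterated fusion $*$ in lexicographic order of the indices, $$\Theta^*_{n,k}:=\Big[\bigotimes_{i,j<n}((p_{i,j}\wedge1)\vee(q_{i,j}\wedge1))\Big]\setminus\Big(\Big[\bigotimes_{i<n,\,l<k}((s_{i,l}\wedge1)\vee(s'_{i,l}\wedge1))\setminus\alpha^k_n\Big]\vee\Big[\bigotimes_{i<n,\,l<k+1}((r_{i,l}\wedge1)\vee(r'_{i,l}\wedge1))\setminus\beta^{k+1}_n\Big]\Big),$$ and $\Theta^*_n:=\Theta^*_{n,\lfloor\sqrt n\rfloor}$. *)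

(* Defs.v *)
From HB Require Import structures.
From mathcomp Require Import all_boot.
From mathcomp Require Import finmap multiset.

Set Implicit Arguments.
Unset Strict Implicit.
Unset Printing Implicit Defensive.

Local Open Scope mset_scope.

(* Formulas over {/\, \/, *, \, /, 1, 0}.
   [FUnder a b] is  a \ b  and  [FOver b a] is  b / a. *)
Inductive fl_formula (V : Type) : Type :=
| FVar of V
| FAnd of fl_formula V & fl_formula V
| FOr of fl_formula V & fl_formula V
| FFus of fl_formula V & fl_formula V
| FUnder of fl_formula V & fl_formula V
| FOver of fl_formula V & fl_formula V
| FOne
| FZero.

Arguments FOne {V}.
Arguments FZero {V}.

(* Formulas over {/\, \/, ->, top, bottom}. *)
Inductive formula (V : Type) : Type :=
| Var of V
| And of formula V & formula V
| Or of formula V & formula V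
| Imp of formula V & formula V
| Top
| Bot.

Arguments Top {V}.
Arguments Bot {V}.

Fixpoint formula_encode V (f : formula V) : GenTree.tree V :=
  match f with
  | Var v => GenTree.Leaf v
  | And a b => GenTree.Node 0 [:: formula_encode a; formula_encode b]
  | Or a b => GenTree.Node 1 [:: formula_encode a; formula_encode b]
  | Imp a b => GenTree.Node 2 [:: formula_encode a; formula_encode b]
  | Top => GenTree.Node 3 [::]
  | Bot => GenTree.Node 4 [::]
  end.

Fixpoint formula_decode V (t : GenTree.tree V) : formula V :=
  match t with
  | GenTree.Leaf v => Var v
  | GenTree.Node 0 [:: a; b] => And (formula_decode a) (formula_decode b)
  | GenTree.Node 1 [:: a; b] => Or (formula_decode a) (formula_decode b)
  | GenTree.Node 2 [:: a; b] => Imp (formula_decode a) (formula_decode b)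
  | GenTree.Node 3 _ => Top
  | _ => Bot
  end.

Lemma formula_encodeK V : cancel (@formula_encode V) (@formula_decode V).
Proof. by elim=> //= a -> b ->. Qed.

HB.instance Definition _ (V : choiceType) :=
  Choice.copy (formula V) (can_type (@formula_encodeK V)).

Fixpoint transl V (f : fl_formula V) : formula V :=
  match f with
  | FVar v => Var v
  | FAnd a b => And (transl a) (transl b)
  | FOr a b => Or (transl a) (transl b)
  | FFus a b => And (transl a) (transl b)
  | FUnder a b => Imp (transl a) (transl b)
  | FOver b a => Imp (transl a) (transl b)
  | FOne => Top
  | FZero => Bot
  end.

Definition sequent (V : choiceType) : Type :=
  ({mset formula V} * {mset formula V})%type.

Notation "Y |=> X" := (Y, X) (at level 70, no associativity, only parsing).

(* [bpc_rule premises conclusion]; initial sequents have no premises. *)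
Inductive bpc_rule (V : choiceType) : seq (sequent V) -> sequent V -> Prop :=
| bpc_ax f (Y X : {mset formula V}) :
    bpc_rule [::] (f +` Y |=> f +` X)
| bpc_top (Y X : {mset formula V}) :
    bpc_rule [::] (Y |=> Top +` X)
| bpc_bot (Y X : {mset formula V}) :
    bpc_rule [::] (Bot +` Y |=> X)
| bpc_Land f g (Y X : {mset formula V}) :
    bpc_rule [:: f +` (g +` Y) |=> X] (And f g +` Y |=> X)
| bpc_Rand f g (Y X : {mset formula V}) :
    bpc_rule [:: Y |=> f +` X; Y |=> g +` X] (Y |=> And f g +` X)
| bpc_Lor f g (Y X : {mset formula V}) :
    bpc_rule [:: f +` Y |=> X; g +` Y |=> X] (Or f g +` Y |=> X)
| bpc_Ror f g (Y X : {mset formula V}) :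
    bpc_rule [:: Y |=> f +` (g +` X)] (Y |=> Or f g +` X)
| bpc_Rimp f g (Y X : {mset formula V}) :
    bpc_rule [:: f +` Y |=> [mset g]] (Y |=> Imp f g +` X)
| bpc_D f g h (Y X : {mset formula V}) :
    bpc_rule [:: And f g +` Y |=> X; And f h +` Y |=> X]
             (And f (Or g h) +` Y |=> X)
| bpc_Tr f g h (Y X : {mset formula V}) :
    bpc_rule [:: Y |=> [mset Imp f g]; Y |=> [mset Imp g h]]
             (Y |=> Imp f h +` X)
| bpc_Fand f g h (Y X : {mset formula V}) :
    bpc_rule [:: Y |=> [mset Imp f g]; Y |=> [mset Imp f h]]
             (Y |=> Imp f (And g h) +` X)
| bpc_For f g h (Y X : {mset formula V}) :
    bpc_rule [:: Y |=> [mset Imp f h]; Y |=> [mset Imp g h]]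
             (Y |=> Imp (Or f g) h +` X)
| bpc_cut f (Y1 Y2 X1 X2 : {mset formula V}) :
    bpc_rule [:: Y1 |=> f +` X1; f +` Y2 |=> X2] (Y1 `+` Y2 |=> X1 `+` X2).

(* Dag-like derivations: sequences of lines, each inferred from earlier lines,
   which may be reused any number of times. *)
Inductive bpc_derivation (V : choiceType) : seq (sequent V) -> Prop :=
| bpc_nil : bpc_derivation [::]
| bpc_step pi prems S :
    bpc_derivation pi -> {subset prems <= pi} -> bpc_rule prems S ->
    bpc_derivation (rcons pi S).

Definition bpc_proof (V : choiceType) (S : sequent V) (pi : seq (sequent V)) :=
  bpc_derivation pi /\ exists pi0, pi = rcons pi0 S.

Definition bpc_provable (V : choiceType) (S : sequent V) :=
  exists pi, bpc_proof S pi.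

Inductive var : Type :=
| vp of nat & nat | vq of nat & nat
| vs of nat & nat | vs' of nat & nat
| vr of nat & nat | vr' of nat & nat.

Definition var_encode (v : var) : nat * nat * nat :=
  match v with
  | vp i j => (0, i, j) | vq i j => (1, i, j)
  | vs i l => (2, i, l) | vs' i l => (3, i, l)
  | vr i l => (4, i, l) | vr' i l => (5, i, l)
  end.

Definition var_decode (c : nat * nat * nat) : var :=
  match c with
  | (0, i, j) => vp i j | (1, i, j) => vq i j
  | (2, i, l) => vs i l | (3, i, l) => vs' i l
  | (4, i, l) => vr i l | (_, i, l) => vr' i l
  end.

Lemma var_encodeK : cancel var_encode var_decode.
Proof. by case. Qed.

HB.instance Definition _ := Countable.copy var (can_type var_encodeK).

(* Iterated connectives associate to the left and no unit is added:
   [iter_op op e [:: a; b; c] = op (op a b) c].  The default [e] is the value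
   on the empty sequence only. *)
Definition iter_op (T : Type) (op : T -> T -> T) (e : T) (s : seq T) : T :=
  if s is x :: s' then foldl op x s' else e.

Definition bigand : seq (fl_formula var) -> fl_formula var :=
  iter_op (@FAnd var) FOne.
Definition bigor : seq (fl_formula var) -> fl_formula var :=
  iter_op (@FOr var) FZero.
Definition bigfus : seq (fl_formula var) -> fl_formula var :=
  iter_op (@FFus var) FOne.

Definition alpha (n k : nat) : fl_formula var :=
  FOr
    (bigor [seq bigand [seq FVar (vs' i l) | l <- iota 0 k] | i <- iota 0 n])
    (bigor [seq bigor [seq FAnd (FAnd (FVar (vs i l)) (FVar (vs j l)))
                                (FVar (vp i j)) | l <- iota 0 k]
           | i <- iota 0 n, j <- iota 0 n]).

(* [beta n k.+1] is the formula written with upper index k+1. *)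
Definition beta (n K : nat) : fl_formula var :=
  FOr
    (bigor [seq bigand [seq FVar (vr' i l) | i <- iota 0 n] | l <- iota 0 K])
    (bigor [seq bigor [seq FAnd (FAnd (FVar (vr i l)) (FVar (vr j m)))
                                (FVar (vq i j))
                      | l <- iota 0 K, m <- [seq m <- iota 0 K | l < m]]
           | i <- iota 0 n, j <- iota 0 n]).

Definition choice1 (x y : var) : fl_formula var :=
  FOr (FAnd (FVar x) FOne) (FAnd (FVar y) FOne).

Definition Theta_nk (n k : nat) : fl_formula var :=
  FUnder
    (bigfus [seq choice1 (vp i j) (vq i j) | i <- iota 0 n, j <- iota 0 n])
    (FOr
      (FUnder
        (bigfus [seq choice1 (vs i l) (vs' i l) | i <- iota 0 n, l <- iota 0 k])
        (alpha n k))
      (FUnder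
        (bigfus [seq choice1 (vr i l) (vr' i l)
                | i <- iota 0 n, l <- iota 0 k.+1])
        (beta n k.+1))).

Definition Theta (n : nat) : fl_formula var := Theta_nk n (Nat.sqrt n).

Definition Theta_sequent (n : nat) : sequent var :=
  (mset0 |=> [mset transl (Theta n)]).

(* Main.v *)
Require Import Defs.
From mathcomp Require Import all_boot all_order all_algebra.
From mathcomp Require Import finmap multiset zify ring.
From mathcomp Require Import reals exp.
From Stdlib Require PeanoNat.

(** Given the [p]'s and [q]'s, either the graph has no [k]-colouring, so that
    the first implication of the succedent is valid, or it has one, hence no
    [k+1]-clique, and the second is valid; both are then derived from atoms.

    For the lower bound, a proof is read as a set of Horn clauses, one for each
    line introducing an implication: its least model, in which implications are
    atoms, makes every line true and is closed under modus ponens. Hence it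
    decides which of the two implications holds, monotonically in [p] and [q].
    With all [q]'s set to true this is a monotone circuit, of size polynomial in
    the number of lines, that accepts the [k+1]-cliques and rejects the
    [k]-coloured graphs. Razborov's approximation method (in the form of Alon
    and Boppana) then gives the exponential bound. *)

Set Implicit Arguments.
Unset Strict Implicit.
Unset Printing Implicit Defensive.

(** * Classical semantics and provability *)

(** What is counted is lines, not symbols: a sequent may contain arbitrarily many formulas of
    arbitrary size. So at most four formulas per line are analysed, and gates are counted as
    distinct sets of tests, under which a wide context collapses to polynomially many functions.

    The calculus has no left rule for implication, so modus ponens cannot be read off from the truth
    of the lines alone; it holds in the least model because an implication is true there only when a
    clause fired at some stage, and that stage is what the induction runs on. Modus ponens applied
    to the end sequent yields a true disjunction, hence a true disjunct; classical soundness of the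
    clauses then excludes the wrong disjunct.

    The test graphs are taken from two product spaces: transversals of [k+1] blocks of vertices, and
    arbitrary maps to [k] colours. All probability estimates of the approximation method thereby
    reduce to resetting one coordinate of a function, with no binomial coefficients. *)

Fixpoint ceval V (e : V -> bool) (f : formula V) : bool :=
  match f with
  | Var x => e x
  | And g h => ceval e g && ceval e h
  | Or g h => ceval e g || ceval e h
  | Imp g h => ceval e g ==> ceval e h
  | Top => true
  | Bot => false
  end.

Fixpoint imp_free V (f : formula V) : bool :=
  match f with
  | And g h | Or g h => imp_free g && imp_free h
  | Imp _ _ => false
  | _ => true
  end.

Fixpoint fsize V (f : formula V) : nat :=
  match f with
  | And g h | Or g h | Imp g h => (fsize g + fsize h).+1
  | _ => 1
  end.

Lemma all_allpairs_dep S T (U : Type) (a : pred U) (f : S -> T -> U) s (t : S -> seq T) :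
  all a [seq f i j | i <- s, j <- t i] = all (fun i => all (fun j => a (f i j)) (t i)) s.
Proof. by elim: s => //= i s <-; rewrite all_cat all_map. Qed.

Lemma has_allpairs_dep S T (U : Type) (a : pred U) (f : S -> T -> U) s (t : S -> seq T) :
  has a [seq f i j | i <- s, j <- t i] = has (fun i => has (fun j => a (f i j)) (t i)) s.
Proof. by elim: s => //= i s <-; rewrite has_cat has_map. Qed.

Lemma all_iotaP (a : pred nat) n : reflect (forall i, i < n -> a i) (all a (iota 0 n)).
Proof.
by apply: (iffP allP) => H i; [move=> lti; apply: H; rewrite mem_iota |
  rewrite mem_iota; apply: H].
Qed.

Lemma has_iotaP (a : pred nat) n : reflect (exists2 i, i < n & a i) (has a (iota 0 n)).
Proof.
apply: (iffP hasP) => -[i]; first by rewrite mem_iota; exists i.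
by move=> lti ai; exists i; rewrite ?mem_iota.
Qed.

Section IteratedConnectives.

Variable e : var -> bool.
Local Notation tr f := (ceval e (transl f)).

Lemma ceval_bigand s : tr (bigand s) = all (fun f => tr f) s.
Proof.
case: s => //= x s; rewrite /bigand /=; elim: s x => [|y s IH] x /=.
  by rewrite andbT.
by rewrite IH /= andbA.
Qed.

Lemma ceval_bigfus s : tr (bigfus s) = all (fun f => tr f) s.
Proof.
case: s => //= x s; rewrite /bigfus /=; elim: s x => [|y s IH] x /=.
  by rewrite andbT.
by rewrite IH /= andbA.
Qed.

Lemma ceval_bigor s : tr (bigor s) = has (fun f => tr f) s.
Proof.
case: s => //= x s; rewrite /bigor /=; elim: s x => [|y s IH] x /=.
  by rewrite orbF.
by rewrite IH /= orbA.
Qed.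

Lemma ceval_choicesP (x y : nat -> nat -> var) n m :
  reflect (forall i j, i < n -> j < m -> e (x i j) || e (y i j))
          (tr (bigfus [seq choice1 (x i j) (y i j) | i <- iota 0 n, j <- iota 0 m])).
Proof.
rewrite ceval_bigfus all_allpairs_dep.
apply: (iffP (all_iotaP _ _)) => [H i j ltin ltjm | H i ltin].
  by have /all_iotaP/(_ j ltjm) /= := H i ltin; rewrite !andbT.
by apply/all_iotaP => j ltjm /=; rewrite !andbT H.
Qed.

Lemma ceval_alphaP n k :
  reflect ((exists2 i, i < n & forall l, l < k -> e (vs' i l)) \/
           exists i j l, [/\ i < n, j < n, l < k &
                             [/\ e (vs i l), e (vs j l) & e (vp i j)]])
          (tr (alpha n k)).
Proof.
rewrite /= !ceval_bigor has_map has_allpairs_dep.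
apply: (iffP orP) => -[] H; [left|right|left|right]; move: H.
- case/has_iotaP=> i ltin /=; rewrite ceval_bigand all_map => /all_iotaP H.
  by exists i => // l /H.
- case/has_iotaP=> i ltin /has_iotaP[j ltjn]; rewrite ceval_bigor has_map.
  case/has_iotaP=> l ltlk /= /andP[/andP[si sj] pij].
  by exists i, j, l.
- case=> i ltin H; apply/has_iotaP; exists i => //=.
  by rewrite ceval_bigand all_map; apply/all_iotaP.
- case=> i [j [l [ltin ltjn ltlk [si sj pij]]]].
  apply/has_iotaP; exists i => //; apply/has_iotaP; exists j => //.
  rewrite ceval_bigor has_map; apply/has_iotaP; exists l => //.
  by rewrite /= si sj pij.
Qed.

Lemma ceval_betaP n K :
  reflect ((exists2 l, l < K & forall i, i < n -> e (vr' i l)) \/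
           exists i j l m, [/\ i < n, j < n, l < m, m < K &
                               [/\ e (vr i l), e (vr j m) & e (vq i j)]])
          (tr (beta n K)).
Proof.
rewrite /= !ceval_bigor has_map has_allpairs_dep.
apply: (iffP orP) => -[] H; [left|right|left|right]; move: H.
- case/has_iotaP=> l ltlK /=; rewrite ceval_bigand all_map => /all_iotaP H.
  by exists l => // i /H.
- case/has_iotaP=> i ltin /has_iotaP[j ltjn]; rewrite ceval_bigor has_allpairs_dep.
  case/has_iotaP=> l ltlK /hasP[m]; rewrite mem_filter mem_iota.
  move=> /andP[ltlm ltmK] /= /andP[/andP[ri rj] qij].
  by exists i, j, l, m.
- case=> l ltlK H; apply/has_iotaP; exists l => //=.
  by rewrite ceval_bigand all_map; apply/all_iotaP.
- case=> i [j [l [m [ltin ltjn ltlm ltmK [ri rj qij]]]]].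
  apply/has_iotaP; exists i => //; apply/has_iotaP; exists j => //.
  rewrite ceval_bigor has_allpairs_dep; apply/has_iotaP; exists l.
    exact: ltn_trans ltmK.
  apply/hasP; exists m; first by rewrite mem_filter mem_iota ltlm.
  by rewrite /= ri rj qij.
Qed.

End IteratedConnectives.

Lemma imp_free_iter (op : fl_formula var -> fl_formula var -> fl_formula var) c s :
  (forall f g, imp_free (transl (op f g)) =
               imp_free (transl f) && imp_free (transl g)) ->
  imp_free (transl c) -> all (fun f => imp_free (transl f)) s ->
  imp_free (transl (iter_op op c s)).
Proof.
move=> Hop Hc; case: s => //= x s /andP[].
by elim: s x => [|y s IH] x //= Hx /andP[Hy Hs]; apply: IH; rewrite // Hop Hx.
Qed.

Lemma imp_free_choices (x y : nat -> nat -> var) n m :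
  imp_free (transl (bigfus
    [seq choice1 (x i j) (y i j) | i <- iota 0 n, j <- iota 0 m])).
Proof.
by apply: imp_free_iter => //; rewrite all_allpairs_dep; do 2!apply/allP=> ? _.
Qed.

Lemma imp_free_alpha n k : imp_free (transl (alpha n k)).
Proof.
rewrite /=; apply/andP; split; apply: imp_free_iter => //.
  rewrite all_map; apply/allP=> i _; apply: imp_free_iter => //.
  by rewrite all_map; apply/allP.
rewrite all_allpairs_dep; do 2!apply/allP=> ? _; apply: imp_free_iter => //.
by rewrite all_map; apply/allP.
Qed.

Lemma imp_free_beta n K : imp_free (transl (beta n K)).
Proof.
rewrite /=; apply/andP; split; apply: imp_free_iter => //.
  rewrite all_map; apply/allP=> i _; apply: imp_free_iter => //.
  by rewrite all_map; apply/allP.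
rewrite all_allpairs_dep; do 2!apply/allP=> ? _; apply: imp_free_iter => //.
by rewrite all_allpairs_dep; do 2!apply/allP=> ? _.
Qed.

(** * Derivability of implication-free formulas by evaluation at atoms *)

Section Provability.

Variable V : choiceType.
Local Open Scope mset_scope.

Lemma bpc_derivation_cat (pi1 pi2 : seq (sequent V)) :
  bpc_derivation pi1 -> bpc_derivation pi2 -> bpc_derivation (pi1 ++ pi2).
Proof.
move=> d1; elim=> [|pi prems S _ IH sub r]; first by rewrite cats0.
rewrite -rcons_cat; apply: bpc_step r => // T /sub.
by rewrite mem_cat orbC => ->.
Qed.

Lemma bpc_provable_rule prems (S : sequent V) :
  bpc_rule prems S -> {in prems, forall T, bpc_provable T} -> bpc_provable S.
Proof.
move=> r H; suff [pi [d sub]] : exists pi, bpc_derivation pi /\ {subset prems <= pi}.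
  exists (rcons pi S); split; last by exists pi.
  exact: bpc_step r.
elim: prems {r} H => [|T prems IH] H; first by exists [::]; split=> //; constructor.
have [|pi [d sub]] := IH; first by move=> U HU; apply: H; rewrite inE HU orbT.
have [pi1 [d1 [pi0 E]]] := H T (mem_head _ _).
exists (pi1 ++ pi); split; first exact: bpc_derivation_cat.
move=> U; rewrite inE mem_cat => /orP[/eqP->|/sub ->]; last by rewrite orbT.
by rewrite E mem_rcons mem_head.
Qed.

Lemma seq_mset1 (f : formula V) : seq_mset [:: f] = [mset f].
Proof. by apply/msetP=> g; rewrite mset_seqE msetnE /= addn0 eq_sym; case: eqP. Qed.

Definition atoms (B : {mset formula V}) (x : V) : bool := Var x \in B.

(** The left rules, read backwards, split [G] down to variables, which are moved into [A]. Each open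
    branch ends in a context whose atoms, taken as a valuation, satisfy all of [G]. *)
Lemma bpc_left_atoms (X : {mset formula V}) (G : seq (formula V)) (A : {mset formula V}) :
  all (@imp_free V) G ->
  (forall B : {mset formula V}, {subset A <= B} -> all (ceval (atoms B)) G ->
     bpc_provable (B |=> X)) ->
  bpc_provable (seq_mset G `+` A |=> X).
Proof.
elim: {G}_.+1 {-2}G (ltnSn (sumn [seq fsize f | f <- G])) A => // N IH [|f G] ltN A.
  by move=> _ H; rewrite (_ : seq_mset [::] = mset0) ?mset0D;
    [apply: H | apply/msetP => f; rewrite mset_seqE mset0E].
have step (h : formula V) : imp_free h ->
    (forall B : {mset formula V}, h \in B -> ceval (atoms B) h) ->
    sumn [seq fsize f | f <- G] < N ->
    all (@imp_free V) (h :: G) ->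
    (forall B : {mset formula V}, {subset A <= B} -> all (ceval (atoms B)) (h :: G) ->
      bpc_provable (B |=> X)) -> bpc_provable (seq_mset (h :: G) `+` A |=> X).
  move=> _ Hh lt' /= /andP[_ fG] H.
  rewrite mset_cons -msetDA msetDCA; apply: IH => // B sub HB.
  apply: H => [g gA|]; first by apply: sub; rewrite in_mset1D gA orbT.
  by rewrite HB andbT Hh // sub // mset1D1.
case: f ltN => [x|g h|g h|g h||] ltN.
- by apply: step => //; move: ltN => /=; lia.
- move=> /= /andP[/andP[fg fh] fG] H.
  rewrite mset_cons -msetDA; apply: bpc_provable_rule (bpc_Land _ _ _ _) _ => T.
  rewrite inE => /eqP->.
  rewrite (_ : g +` (h +` _) = seq_mset [:: g, h & G] `+` A); last by rewrite !mset_cons !msetDA.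
  apply: IH; rewrite /= ?fg ?fh //; first by move: ltN => /=; lia.
  by move=> B sub HB; apply: H => //; rewrite -andbA.
- move=> /= /andP[/andP[fg fh] fG] H.
  rewrite mset_cons -msetDA; apply: bpc_provable_rule (bpc_Lor _ _ _ _) _ => T.
  rewrite !inE => /orP[] /eqP->; rewrite msetDA -mset_cons; apply: IH;
    rewrite /= ?fg ?fh //; do 1?by move: ltN => /=; lia.
  + by move=> B sub /andP[Hg HG]; apply: H => //; rewrite Hg.
  + by move=> B sub /andP[Hg HG]; apply: H => //; rewrite Hg orbT.
- by [].
- by apply: step => //; move: ltN => /=; lia.
- move=> _ _; rewrite mset_cons -msetDA.
  exact: bpc_provable_rule (bpc_bot _ _) _.
Qed.

Lemma bpc_right_eval (B : {mset formula V}) (f : formula V) (X : {mset formula V}) :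
  imp_free f -> ceval (atoms B) f -> bpc_provable (B |=> f +` X).
Proof.
elim: f X => [x|g IHg h IHh|g IHg h IHh|g IHg h IHh||] X //=.
- move=> _ xB; rewrite -(msetB1K xB).
  exact: bpc_provable_rule (bpc_ax _ _ _) _.
- move=> /andP[fg fh] /andP[Hg Hh]; apply: bpc_provable_rule (bpc_Rand _ _ _ _) _.
  by move=> T; rewrite !inE => /orP[] /eqP->; [apply: IHg | apply: IHh].
- move=> /andP[fg fh] H; apply: bpc_provable_rule (bpc_Ror _ _ _ _) _.
  move=> T; rewrite inE => /eqP->; case/orP: H => H; first exact: IHg.
  by rewrite msetDCA; apply: IHh.
- by move=> _ _; apply: bpc_provable_rule (bpc_top _ _) _.
Qed.

(** [(R->)] keeps the context [B] and adds [f], so each branch ends in a context with more atoms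
    than [B]; this is why every valuation above [atoms B] must be considered, as in Kripke
    semantics. *)
Lemma bpc_Rimp_eval (B : {mset formula V}) (f g : formula V) (X : {mset formula V}) :
  imp_free f -> imp_free g ->
  (forall e : V -> bool, (forall x, atoms B x -> e x) -> ceval e f -> ceval e g) ->
  bpc_provable (B |=> Imp f g +` X).
Proof.
move=> ff fg H; apply: bpc_provable_rule (bpc_Rimp _ _ _ _) _ => T.
rewrite inE => /eqP->; rewrite -[[mset f]]seq_mset1.
apply: bpc_left_atoms => [|C sub /= /andP[Cf _]]; first by rewrite /= ff.
rewrite -[[mset g]]msetD0; apply: bpc_right_eval => //.
by apply: H Cf => x xB; apply: sub.
Qed.

End Provability.

(** The dichotomy depends on [a] alone, before the colouring or clique encoded by [e] is known. This
    order is what allows one of the two implications to be chosen on the right. *)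
Lemma colour_or_clique_free n k (a : var -> bool) :
  (forall i j, i < n -> j < n -> a (vp i j) || a (vq i j)) ->
  (forall e : var -> bool, (forall x, a x -> e x) ->
     (forall i l, i < n -> l < k -> e (vs i l) || e (vs' i l)) ->
     ceval e (transl (alpha n k))) \/
  (forall e : var -> bool, (forall x, a x -> e x) ->
     (forall i l, i < n -> l < k.+1 -> e (vr i l) || e (vr' i l)) ->
     ceval e (transl (beta n k.+1))).
Proof.
move=> apq.
have [/existsP[c /forallP proper] | noc] :=
  boolP [exists c : {ffun 'I_n -> 'I_k},
           [forall i : 'I_n, forall j : 'I_n, a (vp i j) ==> (c i != c j)]]; [right|left].
- move=> e lee Hr; have [/existsP[l /forallP H]|noT] :=
    boolP [exists l : 'I_k.+1, [forall i : 'I_n, e (vr' i l)]].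
    by apply/ceval_betaP; left; exists l => // i lti; apply: (H (Ordinal lti)).
  have ex (l : 'I_k.+1) : exists i : 'I_n, e (vr i l).
    apply/existsP; apply: contraR noT => /existsPn Hn; apply/existsP; exists l.
    apply/forallP=> i; have := Hr i l (ltn_ord i) (ltn_ord l).
    by rewrite (negbTE (Hn i)).
  (* The [k+1] clique positions receive vertices [v l], and two of these share a colour. A proper
     colouring excludes [p] between them, even when they coincide, so [q] holds there. *)
  pose v l := xchoose (ex l); have vP l : e (vr (v l) l) := xchooseP (ex l).
  have [inj|/injectivePn[l [m nelm E]]] := boolP (injectiveb (fun l => c (v l))).
    by have := leq_card _ (injectiveP _ inj); rewrite !card_ord ltnn.
  apply/ceval_betaP; right.
  wlog ltlm : l m nelm E / l < m.
    move=> W; have [lt|ge] := ltnP l m; first exact: (W l m).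
    apply: (W m l) => //; first by rewrite eq_sym.
    by rewrite ltn_neqAle ge andbT eq_sym.
  exists (v l), (v m), l, m; split=> //; split=> //; apply: lee.
  have := apq (v l) (v m) (ltn_ord _) (ltn_ord _).
  have /forallP/(_ (v m)) := proper (v l); rewrite E eqxx implybF.
  by move/negbTE->.
- move=> e lee Hs; have [/existsP[i /forallP H]|noT] :=
    boolP [exists i : 'I_n, [forall l : 'I_k, e (vs' i l)]].
    by apply/ceval_alphaP; left; exists i => // l ltl; apply: (H (Ordinal ltl)).
  have ex (i : 'I_n) : exists l : 'I_k, e (vs i l).
    apply/existsP; apply: contraR noT => /existsPn Hn; apply/existsP; exists i.
    apply/forallP=> l; have := Hs i l (ltn_ord i) (ltn_ord l).
    by rewrite (negbTE (Hn l)).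
  (* The colouring read off from [e] is not proper, and a monochromatic edge is a disjunct of
     [alpha]. *)
  pose c := [ffun i => xchoose (ex i)].
  have cP (i : 'I_n) : e (vs i (c i)) by rewrite ffunE (xchooseP (ex i)).
  move/existsPn/(_ c): noc => /forallPn[/= i /forallPn[/= j]].
  rewrite negb_imply negbK => /andP[pij /eqP E].
  apply/ceval_alphaP; right; exists i, j, (c i); split=> //; split=> //.
    by rewrite E.
  exact: lee.
Qed.

Lemma Theta_provable n : bpc_provable (Theta_sequent n).
Proof.
rewrite /Theta_sequent -[[mset _]%mset]msetD0 /Theta /Theta_nk.
set k := Nat.sqrt n.
(* Hiding the successor keeps simplification from unfolding [iota 0 k.+1]. *)
have [K EK] : exists K, K = k.+1 by exists k.+1.
rewrite -EK; cbn [transl].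
apply: bpc_provable_rule (bpc_Rimp _ _ _ _) _ => T; rewrite inE => /eqP->.
rewrite -seq_mset1.
apply: bpc_left_atoms => [|B _]; first by rewrite /= imp_free_choices.
rewrite /= andbT => /ceval_choicesP/(@colour_or_clique_free _ k); rewrite -EK => H.
rewrite -[[mset _]%mset]msetD0; apply: bpc_provable_rule (bpc_Ror _ _ _ _) _ => T'.
rewrite inE => /eqP->; case: H => H.
  apply: bpc_Rimp_eval; rewrite ?imp_free_choices ?imp_free_alpha // => e lee.
  by move/ceval_choicesP; apply: H.
rewrite msetDCA.
apply: bpc_Rimp_eval; rewrite ?imp_free_choices ?imp_free_beta // => e lee.
by move/ceval_choicesP; apply: H.
Qed.

(** * Horn clauses of a proof *)

Section HornClosure.

Variable V : choiceType.
Local Open Scope mset_scope.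
Implicit Types (f g h : formula V) (Dc : seq (formula V)) (a e : V -> bool).
Implicit Types (v I : formula V -> bool) (S T : sequent V).

Definition sat v S :=
  (forall f, f \in S.1 -> v f) -> exists2 f, f \in S.2 & v f.

Definition boolean_at v f : Prop :=
  match f with
  | And g h => v f = v g && v h
  | Or g h => v f = v g || v h
  | Imp _ _ | Var _ => True
  | Top => v f
  | Bot => ~~ v f
  end.

Definition clause := (seq (formula V) * (formula V * formula V))%type.
Definition chead (c : clause) : formula V := Imp c.2.1 c.2.2.
Implicit Types (c : clause) (Cl : seq clause).

Definition closed Cl v := forall c, c \in Cl -> all v c.1 -> v (chead c).

(* The connectives of a formula outside [Dc] are not analysed: such a formula
   is false, which keeps the number of relevant formulas linear in the number
   of lines even when the formulas in the proof are huge. *)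
Fixpoint ev Dc a I f : bool :=
  match f with
  | Var x => a x
  | And g h => [&& And g h \in Dc, ev Dc a I g & ev Dc a I h]
  | Or g h => (Or g h \in Dc) && (ev Dc a I g || ev Dc a I h)
  | Imp g h => I (Imp g h)
  | Top => true
  | Bot => false
  end.

(* Closure under modus ponens is proved along the stages of the least model:
   [I0] is an earlier stage of [I]. *)
Definition mp_step Dc a I c := forall I0 : formula V -> bool,
  (forall f, I0 f -> I f) ->
  (forall f g, I0 (Imp f g) -> ev Dc a I f -> ev Dc a I g) ->
  all (ev Dc a I0) c.1 -> ev Dc a I c.2.1 -> ev Dc a I c.2.2.

Lemma ev_mono Dc a a' I I' f : (forall x, a x -> a' x) -> (forall g, I g -> I' g) ->
  ev Dc a I f -> ev Dc a' I' f.
Proof.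
move=> lea leI; elim: f => [x|g IHg h IHh|g IHg h IHh|g _ h _||] //=.
- exact: lea.
- by case/and3P=> -> /IHg-> /IHh->.
- by case/andP=> -> /orP[/IHg->|/IHh->]; rewrite ?orbT.
- exact: leI.
Qed.

Lemma ev_boolean_at Dc a I f : f \in Dc -> boolean_at (ev Dc a I) f.
Proof. by case: f => //= g h ->. Qed.

(** The valuation in the first condition is arbitrary so that it serves twice: for the least model,
    through [ev], and for classical soundness, through [ceval]. *)
Definition rule_clauses_spec (prems : seq (sequent V)) S Cl Dc :=
  [/\ forall v, v Top -> ~~ v Bot -> {in Dc, forall f, boolean_at v f} -> closed Cl v ->
        {in prems, forall T, sat v T} -> sat v S,
      forall Dc' a I, {subset Dc <= Dc'} -> {in prems, forall T, sat (ev Dc' a I) T} ->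
        {in Cl, forall c, mp_step Dc' a I c} &
      (forall e, {in prems, forall T, sat (ceval e) T}) -> forall e, closed Cl (ceval e)].

(** Only [(R->)], [(Tr)] and the two [(F)] rules create an implication and give a clause. The bound
    4 is attained at [(D)], which involves two conjunctions, a disjunction and the conjunction of
    [f] with it. *)
Lemma rule_clauses prems S : bpc_rule prems S ->
  exists Cl Dc, [/\ size Cl <= 1, size Dc <= 4 & rule_clauses_spec prems S Cl Dc].
Proof.
have nil_spec (prems' : seq (sequent V)) S' Dc : size Dc <= 4 ->
  (forall v, v Top -> ~~ v Bot -> {in Dc, forall f, boolean_at v f} ->
     {in prems', forall T, sat v T} -> sat v S') ->
  exists Cl Dc, [/\ size Cl <= 1, size Dc <= 4 & rule_clauses_spec prems' S' Cl Dc].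
  by move=> szD H; exists [::], Dc; split=> //; split=> // v vT vB vD _; apply: H.
have mem1D v (Y : {mset formula V}) f : v f -> (forall g, g \in Y -> v g) ->
    forall g, g \in (f +` Y)%mset -> v g.
  by move=> vf vY g; rewrite in_mset1D => /orP[/eqP->|/vY].
have mem1Dr v (Y : {mset formula V}) f : (forall g, g \in (f +` Y)%mset -> v g) ->
    forall g, g \in Y -> v g.
  by move=> vY g gY; apply: vY; rewrite in_mset1D gY orbT.
have ex1D v (X : {mset formula V}) f : v f -> exists2 g, g \in (f +` X)%mset & v g.
  by exists f; rewrite ?mset1D1.
have exX v (X : {mset formula V}) f : (exists2 g, g \in X & v g) ->
    exists2 g, g \in (f +` X)%mset & v g.
  by case=> g gX vg; exists g; rewrite // in_mset1D gX orbT.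
have ex_inv v (X : {mset formula V}) f : (exists2 g, g \in (f +` X)%mset & v g) ->
    v f \/ exists2 g, g \in X & v g.
  by case=> g; rewrite in_mset1D => /orP[/eqP->|gX vg]; [left|right; exists g].
have ex1_inv v f : (exists2 g, g \in [mset f]%mset & v g) -> v f.
  by case=> g; rewrite in_mset1 => /eqP->.
have p1 (T1 : sequent V) s : T1 \in T1 :: s by exact: mem_head.
have p2 (T1 T2 : sequent V) : T2 \in [:: T1; T2] by rewrite !inE eqxx orbT.
case=> {prems S} [f Y X|Y X|Y X|f g Y X|f g Y X|f g Y X|f g Y X|f g Y X
  |f g h Y X|f g h Y X|f g h Y X|f g h Y X|f Y1 Y2 X1 X2].
- by apply: (nil_spec _ _ [::]) => // v _ _ _ _ /= vY; apply/ex1D/vY/mset1D1.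
- by apply: (nil_spec _ _ [::]) => // v vT _ _ _ /= _; apply/ex1D.
- by apply: (nil_spec _ _ [::]) => // v _ /negP vB _ _ /= vY; case: vB; apply/vY/mset1D1.
- apply: (nil_spec _ _ [:: And f g]) => // v _ _ /(_ _ (mem_head _ _)) /= E H /= vY.
  have := vY _ (mset1D1 _ _); rewrite E => /andP[vf vg].
  by apply: (H _ (p1 _ _)); do 2!apply/mem1D => //; apply: mem1Dr vY.
- apply: (nil_spec _ _ [:: And f g]) => // v _ _ /(_ _ (mem_head _ _)) /= E H /= vY.
  case/ex_inv: (H _ (p1 _ _) vY) => [vf|]; last exact: exX.
  case/ex_inv: (H _ (p2 _ _) vY) => [vg|]; last exact: exX.
  by apply: ex1D; rewrite E vf.
- apply: (nil_spec _ _ [:: Or f g]) => // v _ _ /(_ _ (mem_head _ _)) /= E H /= vY.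
  have := vY _ (mset1D1 _ _); rewrite E => /orP[vf|vg].
    by apply: (H _ (p1 _ _)); apply: mem1D => //; apply: mem1Dr vY.
  by apply: (H _ (p2 _ _)); apply: mem1D => //; apply: mem1Dr vY.
- apply: (nil_spec _ _ [:: Or f g]) => // v _ _ /(_ _ (mem_head _ _)) /= E H /= vY.
  case/ex_inv: (H _ (p1 _ _) vY) => [vf|/ex_inv[vg|]]; last exact: exX.
    by apply: ex1D; rewrite E vf.
  by apply: ex1D; rewrite E vg orbT.
- exists [:: (Y : seq (formula V), (f, g))], [::]; split=> //; split.
  + move=> v _ _ _ /(_ _ (mem_head _ _)) clv _ /= vY; apply/ex1D/clv/allP.
    exact: vY.
  (* The context [Y] held at the earlier stage, hence still holds; with [f] true, the premise line
     yields [g]. *)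
  + move=> Dc' a I _ H c; rewrite mem_seq1 => /eqP-> I0 leI _ /= /allP vY vf.
    apply: ex1_inv; apply: (H _ (p1 _ _)); apply: (mem1D) => [|u uY]; first exact: vf.
    exact: ev_mono (vY u uY).
  + move=> H e c; rewrite mem_seq1 => /eqP-> /= /allP vY; apply/implyP=> vf.
    apply: ex1_inv; apply: (H e _ (p1 _ _)); exact: (mem1D (ceval e) _ _ vf vY).
- apply: (nil_spec _ _ [:: And f (Or g h); Or g h; And f g; And f h]) => // v _ _ vD H /= vY.
  have := vD (And f (Or g h)); have := vD (Or g h).
  have := vD (And f g); have := vD (And f h); rewrite !inE !eqxx !orbT /=.
  move=> /(_ isT) Efh /(_ isT) Efg /(_ isT) Egh /(_ isT) E.
  have := vY _ (mset1D1 _ _); rewrite E Egh => /andP[vf /orP[vg|vh]].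
    by apply: (H _ (p1 _ _)); apply: mem1D => /=; [rewrite Efg vf | apply: mem1Dr vY].
  by apply: (H _ (p2 _ _)); apply: mem1D => /=; [rewrite Efh vf | apply: mem1Dr vY].
- exists [:: ([:: Imp f g; Imp g h], (f, h))], [::]; split=> //; split.
  + move=> v _ _ _ /(_ _ (mem_head _ _)) clv H /= vY; apply/ex1D/clv.
    by rewrite /= (ex1_inv _ _ (H _ (p1 _ _) vY)) (ex1_inv _ _ (H _ (p2 _ _) vY)).
  (* Both premises are implications of the earlier stage, for which modus ponens is already
     available. *)
  + move=> Dc' a I _ _ c; rewrite mem_seq1 => /eqP-> I0 _ mp /= /and3P[I1 I2 _] vf.
    exact: mp I2 (mp _ _ I1 vf).
  + move=> _ e c; rewrite mem_seq1 => /eqP-> /=; by do 3!case: ceval.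
- exists [:: ([:: Imp f g; Imp f h], (f, And g h))], [:: And g h]; split=> //; split.
  + move=> v _ _ _ /(_ _ (mem_head _ _)) clv H /= vY; apply/ex1D/clv.
    by rewrite /= (ex1_inv _ _ (H _ (p1 _ _) vY)) (ex1_inv _ _ (H _ (p2 _ _) vY)).
  + move=> Dc' a I sD _ c; rewrite mem_seq1 => /eqP-> I0 _ mp /= /and3P[I1 I2 _] vf.
    by rewrite sD ?mem_head // (mp _ _ I1 vf) (mp _ _ I2 vf).
  + move=> _ e c; rewrite mem_seq1 => /eqP-> /=; by do 3!case: ceval.
- exists [:: ([:: Imp f h; Imp g h], (Or f g, h))], [:: Or f g]; split=> //; split.
  + move=> v _ _ _ /(_ _ (mem_head _ _)) clv H /= vY; apply/ex1D/clv.
    by rewrite /= (ex1_inv _ _ (H _ (p1 _ _) vY)) (ex1_inv _ _ (H _ (p2 _ _) vY)).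
  + move=> Dc' a I _ _ c; rewrite mem_seq1 => /eqP-> I0 _ mp /= /and3P[I1 I2 _].
    by case/andP=> _ /orP[]; [apply: mp I1 | apply: mp I2].
  + move=> _ e c; rewrite mem_seq1 => /eqP-> /=; by do 3!case: ceval.
- apply: (nil_spec _ _ [::]) => // v _ _ _ H /= vY.
  have vY1 u : u \in Y1 -> v u by move=> uY; apply: vY; rewrite in_msetD uY.
  have vY2 u : u \in Y2 -> v u by move=> uY; apply: vY; rewrite in_msetD uY orbT.
  case/ex_inv: (H _ (p1 _ _) vY1) => [vf|[u uX vu]]; last by exists u; rewrite // in_msetD uX.
  have [u uX vu] := H _ (p2 _ _) (mem1D _ _ _ vf vY2).
  by exists u; rewrite // in_msetD uX orbT.
Qed.

(** [Dc'] may be any larger set, since the pieces of the end sequent have to be analysed as well. *)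
Lemma derivation_clauses pi : bpc_derivation pi ->
  exists Cl Dc, [/\ size Cl <= size pi, size Dc <= 4 * size pi,
    forall Dc' a I, {subset Dc <= Dc'} -> closed Cl (ev Dc' a I) ->
      {in pi, forall S, sat (ev Dc' a I) S} /\ {in Cl, forall c, mp_step Dc' a I c} &
    forall e, closed Cl (ceval e) /\ {in pi, forall S, sat (ceval e) S}].
Proof.
elim=> [|{}pi prems S _ [Cl [Dc [szC szD H sound]]] sub r]; first by exists [::], [::].
have [Cl1 [Dc1 [szC1 szD1 [H1 mp1 sound1]]]] := rule_clauses r.
exists (Cl1 ++ Cl), (Dc1 ++ Dc); rewrite !size_cat size_rcons; split.
- by rewrite -add1n leq_add.
- by rewrite mulnS leq_add.
- move=> Dc' a I sD cl.
  have sD1 : {subset Dc1 <= Dc'} by move=> f fD; apply: sD; rewrite mem_cat fD.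
  have [||lines mp] := H Dc' a I.
  + by move=> f fD; apply: sD; rewrite mem_cat fD orbT.
  + by move=> c cC; apply: cl; rewrite mem_cat cC orbT.
  split=> [T|c].
    rewrite mem_rcons inE => /predU1P[->|/lines//].
    apply: H1 => // [f /sD1|c cC|T0 /sub/lines//]; first exact: ev_boolean_at.
    by apply: cl; rewrite mem_cat cC.
  rewrite mem_cat => /orP[cC|/mp//]; apply: mp1 cC => // T /sub; exact: lines.
- have prem_sat e : {in prems, forall T, sat (ceval e) T}.
    by move=> T /sub; apply: (sound e).2.
  move=> e; split=> [c|T].
    by rewrite mem_cat => /orP[|/(sound e).1//]; apply: sound1.
  rewrite mem_rcons inE => /predU1P[->|/(sound e).2//].
  apply: H1 => //; last exact: sound1.
  by case.
Qed.

(** * Stages of the least model *)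

Section Closure.

Variables (Cl : seq clause) (Dc : seq (formula V)).

Definition fired (J : {set 'I_(size Cl)}) f :=
  [exists i in J, chead (tnth (in_tuple Cl) i) == f].

Definition fire a (J : {set 'I_(size Cl)}) : {set 'I_(size Cl)} :=
  [set i | all (ev Dc a (fired J)) (tnth (in_tuple Cl) i).1].

Definition stage a t := iter t (fire a) set0.
Definition value a t f := ev Dc a (fired (stage a t)) f.

Lemma fired_mono (J J' : {set 'I_(size Cl)}) f : J \subset J' -> fired J f -> fired J' f.
Proof.
by move=> /subsetP sJ /exists_inP[i iJ E]; apply/exists_inP; exists i; rewrite ?sJ.
Qed.

Lemma fire_mono a a' (J J' : {set 'I_(size Cl)}) :
  (forall x, a x -> a' x) -> J \subset J' -> fire a J \subset fire a' J'.
Proof.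
move=> lea sJ; apply/subsetP=> i; rewrite !inE; apply: sub_all => f.
by apply: ev_mono => // g; apply: fired_mono.
Qed.

Lemma value_mono a a' t f : (forall x, a x -> a' x) -> value a t f -> value a' t f.
Proof.
move=> lea; apply: ev_mono => // g; apply: fired_mono.
by elim: t => [|t IH] //=; apply: fire_mono.
Qed.

Lemma mem_stageS a t i :
  (i \in stage a t.+1) = all (value a t) (tnth (in_tuple Cl) i).1.
Proof. by rewrite inE. Qed.

Lemma value_impP a t f g :
  reflect (exists2 i, i \in stage a t & chead (tnth (in_tuple Cl) i) = Imp f g)
          (value a t (Imp f g)).
Proof. by apply: (iffP exists_inP) => -[i iJ /eqP E]; exists i => //; apply/eqP. Qed.

(** A monotone operator on subsets of a set with [size Cl] elements reaches its least fixpoint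
    within [size Cl] steps. *)
Lemma stage_fix a t : stage a t \subset stage a (size Cl).
Proof.
have mono : {homo fire a : J J' / J \subset J'} by move=> J J'; apply: fire_mono.
by have := iter_sub_fix mono t; rewrite /fixset card_ord.
Qed.

Lemma closed_value a : closed Cl (value a (size Cl)).
Proof.
have mono : {homo fire a : J J' / J \subset J'} by move=> J J'; apply: fire_mono.
have E : stage a (size Cl).+1 = stage a (size Cl).
  by have := fixsetK mono; rewrite /fixset card_ord.
move=> c cCl; have /tnthP[i ->] : c \in in_tuple Cl by []; move=> prem; apply/exists_inP; exists i => //.
by rewrite -E mem_stageS.
Qed.

(** Induction on the stage at which the implication appears: the clause that fired has its premises
    true one stage earlier, which is exactly the situation of [mp_step]. *)
Lemma value_mp a f g :
  {in Cl, forall c, mp_step Dc a (fired (stage a (size Cl))) c} ->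
  value a (size Cl) (Imp f g) -> value a (size Cl) f -> value a (size Cl) g.
Proof.
move=> mp.
suff H t f' g' : value a t (Imp f' g') -> value a (size Cl) f' -> value a (size Cl) g'.
  exact: H.
elim: t f' g' => [|t IH] f' g'; case/value_impP=> i; first by rewrite inE.
rewrite mem_stageS => prem [<- <-] vf.
have sub h : fired (stage a t) h -> fired (stage a (size Cl)) h.
  exact: fired_mono (stage_fix _ _).
exact: (mp _ (mem_tnth i (in_tuple Cl)) (fired (stage a t)) sub IH prem vf).
Qed.

(** Leastness: a classical valuation above [a] that satisfies the clauses bounds every stage.
    Declaring unanalysed formulas false only helps. *)
Lemma value_sound a e t f : closed Cl (ceval e) -> (forall x, a x -> e x) ->
  value a t f -> ceval e f.
Proof.
move=> cl lea; elim: t f => [|t IH] f.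
all: elim: f => [x|g IHg h IHh|g IHg h IHh|g _ h _||] //=; try exact: lea.
all: try by rewrite /value /= => /and3P[_ /IHg-> /IHh->].
all: try by rewrite /value /= => /andP[_ /orP[/IHg->|/IHh->]]; rewrite ?orbT.
  by case/value_impP=> i; rewrite inE.
case/value_impP=> i; rewrite mem_stageS => /(sub_all IH) prem E.
by have := cl _ (mem_tnth i (in_tuple Cl)) prem; rewrite E.
Qed.

End Closure.

Fixpoint subf f : seq (formula V) :=
  f :: match f with And g h | Or g h => subf g ++ subf h | _ => [::] end.

Lemma size_subf f : size (subf f) <= fsize f.
Proof.
by elim: f => //= g IHg h IHh; rewrite size_cat ltnS leq_add.
Qed.

Lemma ev_imp_free Dc a I f : imp_free f -> {subset subf f <= Dc} -> ev Dc a I f = ceval a f.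
Proof.
elim: f => //= g IHg h IHh /andP[fg fh] sD; rewrite sD ?mem_head //= IHg ?IHh //.
all: by move=> u uf; apply: sD; rewrite inE mem_cat uf !orbT.
Qed.

End HornClosure.

(** * Monotone circuits separating cliques from colourings *)

(** The Erdős-Rado argument for sets of size at most [s], with the cruder bound [(p * l) ^ s] in
    place of a factorial. [Z] is the core and [S] lists the petals together with it. *)
Lemma sunflower (T : finType) p l s (F : {set {set T}}) : 0 < p -> s <= l ->
  {in F, forall A : {set T}, #|A| <= s} -> (p * l) ^ s < #|F| ->
  exists (Z : {set T}) (S : seq {set T}),
    [/\ uniq S, size S = p, {subset S <= F}, {in S, forall A : {set T}, Z \subset A} &
        {in S &, forall A B : {set T}, A != B -> A :&: B \subset Z}].
Proof.
move=> p_gt0; elim: s F => [|s IH] F le_sl small bigF.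
  have /subset_leq_card : F \subset [set set0].
    by apply/subsetP=> A /small; rewrite leqn0 cards_eq0 inE.
  by rewrite cards1 leqNgt (leq_trans _ bigF).
(* A maximal disjoint subfamily with [p] members is a sunflower with empty core. Otherwise its few
   elements meet every nonempty member of [F], so one element [u] lies in many members; it is
   removed and later added to the core. *)
pose P (D : {set {set T}}) := (D \subset F) && trivIset D.
have P0 : P set0 by rewrite /P sub0set; apply/trivIsetP=> A B; rewrite inE.
have [D /maxsetP[/andP[sDF triv] maxD] _] := maxset_exists P0.
have [le_pD|lt_Dp] := leqP p #|D|.
  exists set0, (take p (enum D)); split=> [|||A _|A B].
  - by rewrite take_uniq ?enum_uniq.
  - by rewrite size_takel // -cardE.
  - by move=> A /mem_take; rewrite mem_enum => /(subsetP sDF).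
  - exact: sub0set.
  move=> /mem_take; rewrite mem_enum => AD /mem_take; rewrite mem_enum => BD ne.
  by have /trivIsetP/(_ A B AD BD ne) := triv; rewrite -setI_eq0 => /eqP->.
pose Fu u := [set A in F | u \in A].
have meet A : A \in F -> A != set0 -> exists2 u, u \in cover D & u \in A.
  move=> AF A0; apply/exists_inP; apply: contraNT A0 => /exists_inPn disj.
  have dA B : B \in D -> [disjoint A & B].
    move=> BD; rewrite disjoint_sym; apply/pred0P=> u /=; apply/negbTE.
    rewrite negb_and -implybE; apply/implyP=> uB; apply: disj.
    by apply/bigcupP; exists B.
  have /maxD E : P (A |: D).
    rewrite /P subUset sub1set AF sDF /=; apply/trivIsetP=> B C.
    rewrite !in_setU1 => /predU1P[->|BD] /predU1P[->|CD]; rewrite ?eqxx //.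
    - by move=> _; apply: dA.
    - by move=> _; rewrite disjoint_sym; apply: dA.
    - exact: (trivIsetP triv).
  have AD : A \in D by rewrite -E ?subsetUr // setU11.
  by have := dA A AD; rewrite -setI_eq0 setIid.
have [/existsP[u big_u]|none] := boolP [exists u, (p * l) ^ s < #|Fu u|]; last first.
  suff le : #|F| <= (p * l) ^ s.+1 by rewrite ltnNge le in bigF.
  have sub : F \subset set0 |: \bigcup_(u in cover D) Fu u.
    apply/subsetP=> A AF; rewrite in_setU1; have [//|A0] := eqVneq A set0.
    have [u uD uA] := meet A AF A0; apply/bigcupP; exists u => //.
    by rewrite inE AF.
  apply: leq_trans (subset_leq_card sub) _; apply: leq_trans (leq_card_setU _ _) _.
  have le1 : #|\bigcup_(u in cover D) Fu u| <= #|cover D| * (p * l) ^ s.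
    rewrite -sum_nat_const; elim/big_rec2: _ => [|u m S _ le]; first by rewrite cards0.
    apply: leq_trans (leq_card_setU _ _) (leq_add _ le).
    by rewrite leqNgt; have /existsPn := none; apply.
  have le2 : #|cover D| <= p.-1 * l.
    apply: leq_trans (_ : #|D| * l <= _); last by rewrite leq_mul2r -ltnS prednK ?lt_Dp ?orbT.
    rewrite -sum_nat_const; apply: leq_trans (leq_card_cover D) _.
    by apply: leq_sum => A /(subsetP sDF)/small le; apply: leq_trans le le_sl.
  (* This term pays for the empty set, the only member of [F] that can miss the cover. *)
  have lpos : 0 < l * (p * l) ^ s by rewrite muln_gt0 expn_gt0 muln_gt0 p_gt0; lia.
  rewrite cards1; apply: leq_trans (leq_add lpos (leq_trans le1 (leq_mul le2 (leqnn _)))) _.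
  by rewrite expnS; set X := (p * l) ^ s; rewrite -!mulnA -mulSn prednK.
pose G := [set A :\ u | A in Fu u].
have cardG : #|G| = #|Fu u|.
  apply: card_in_imset => A B; rewrite !inE => /andP[_ uA] /andP[_ uB] E.
  by rewrite -(setD1K uA) E setD1K.
have [||| Z [S [unS szS sSG ZS disjS]]] := IH G; first exact: ltnW.
- move=> A /imsetP[B]; rewrite inE => /andP[BF uB] ->.
  by have := small B BF; rewrite (cardsD1 u B) uB.
- by rewrite cardG.
have SG A : A \in S -> (u \notin A) * (u |: A \in F).
  by move=> /sSG/imsetP[B]; rewrite inE => /andP[BF uB] ->; rewrite setD11 setD1K.
exists (u |: Z), [seq u |: A | A <- S]; split.
- rewrite map_inj_in_uniq // => A B AS BS E.
  by rewrite -(setU1K (SG A AS).1) E setU1K // (SG B BS).1.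
- by rewrite size_map.
- by move=> _ /mapP[A AS ->]; rewrite (SG A AS).2.
- by move=> _ /mapP[A AS ->]; rewrite setUS // ZS.
move=> _ _ /mapP[A AS ->] /mapP[B BS ->] ne; rewrite -setUIr setUS // disjS //.
by apply: contraNneq ne => ->.
Qed.

(** * Clique indicators and their acceptance probabilities *)

Section LowerBound.
Variables (K b k l : nat).

Local Notation T := ('I_K * 'I_b)%type.

Local Notation test := ({ffun 'I_K -> 'I_b} + {ffun T -> 'I_k})%type.

(* A test is either a clique, one vertex [(i, f i)] in each of the [K] blocks of
   size [b], or the complete multipartite graph of a colouring [c].  A function
   on graphs is represented by the set of tests that it accepts. *)
Definition edge (u w : T) : {set test} :=
  [set x : test | match x with
           | inl f => [&& u != w, f u.1 == u.2 & f w.1 == w.2]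
           | inr c => c u != c w
           end].

(** The clique indicator of [A] in Razborov's method; on a clique test, it asks that [A] lie inside
    that clique. *)
Definition acc_set (A : {set T}) : {set test} :=
  [set x : test | match x with
           | inl f => [forall u in A, f u.1 == u.2]
           | inr c => [forall u in A, forall w in A, (u != w) ==> (c u != c w)]
           end].

Definition acc (F : {set {set T}}) : {set test} := \bigcup_(A in F) acc_set A.

Definition pos (g : {set test}) : {set {ffun 'I_K -> 'I_b}} := [set f | (inl f : test) \in g].
Definition neg (g : {set test}) : {set {ffun T -> 'I_k}} := [set c | (inr c : test) \in g].

Lemma mem_pos g f : (f \in pos g) = (inl f \in g). Proof. by rewrite inE. Qed.
Lemma mem_neg g c : (c \in neg g) = (inr c \in g). Proof. by rewrite inE. Qed.

Definition upd (aT : finType) rT (f : {ffun aT -> rT}) u y : {ffun aT -> rT} :=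
  [ffun w => if w == u then y else f w].

Lemma inr_acc_setP (A : {set T}) (c : {ffun T -> 'I_k}) :
  reflect {in A &, injective c} ((inr c : test) \in acc_set A).
Proof.
rewrite inE; apply: (iffP forall_inP) => [H u w uA wA E | H u uA].
  apply/eqP; have /forall_inP/(_ w wA) := H u uA.
  by rewrite E eqxx implybF negbK.
by apply/forall_inP => w wA; apply/implyP; apply: contraNneq => /H ->.
Qed.

Lemma inl_acc_setP (A : {set T}) (f : {ffun 'I_K -> 'I_b}) :
  reflect {in A, forall u, f u.1 = u.2} ((inl f : test) \in acc_set A).
Proof. by rewrite inE; apply: (iffP forall_inP) => H u /H /eqP. Qed.

Lemma acc_set_sub (A B : {set T}) : A \subset B -> acc_set B \subset acc_set A.
Proof.
move=> /subsetP sAB; apply/subsetP=> -[f|c].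
  by move/inl_acc_setP=> H; apply/inl_acc_setP=> u /sAB/H.
by move/inr_acc_setP=> H; apply/inr_acc_setP=> u w /sAB uB /sAB wB; apply: H.
Qed.

(* The colour of [u] is determined by that of [w], while resetting it freely
   stays inside [B]. *)
Lemma card_neg_collision (B : {set {ffun T -> 'I_k}}) (u w : T) : u != w ->
  (forall c y, c \in B -> upd c u y \in B) ->
  #|[set c in B | c u == c w]| * k <= #|B|.
Proof.
move=> neuw stab; set S := [set c in B | _].
rewrite -[X in _ * X]card_ord -cardsT -cardsX.
rewrite -(card_in_imset (f := fun p => upd p.1 u p.2)).
  apply/subset_leq_card/subsetP=> d /imsetP[[c y]]; rewrite !inE /= => /andP[/andP[cB _] _] ->.
  exact: stab.
move=> [c y] [c' y']; rewrite !inE /= => /andP[/andP[_ /eqP Ec] _] /andP[/andP[_ /eqP Ec'] _].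
move/ffunP=> E; congr (_, _); last by have := E u; rewrite !ffunE eqxx.
apply/ffunP=> v; have := E v; rewrite !ffunE; case: eqP => // -> _.
by have := E w; rewrite !ffunE eq_sym (negbTE neuw) Ec Ec'.
Qed.

(** For a random colouring, the chance of being injective on [Z] but on no member of [s] is at most
    [(l ^ 2 / k) ^ size s]. A collision in [A] has an end [u] outside [Z]; there are at most [l ^ 2]
    pairs, and each collision costs a factor [k]. *)
Lemma card_neg_sunflower (Z : {set T}) (s : seq {set T}) :
  {in s, forall A : {set T}, #|A| <= l} -> uniq s ->
  {in s &, forall A B : {set T}, A != B -> A :&: B \subset Z} ->
  #|neg (acc_set Z) :\: \bigcup_(A <- s) neg (acc_set A)| * k ^ size s
    <= (l ^ 2) ^ size s * k ^ #|{: T}|.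
Proof.
elim: s => [|A s IH] sz un disj.
  rewrite !expn0 muln1 mul1n; apply: leq_trans (max_card _) _.
  by rewrite card_ffun !card_ord.
have {}IH := IH (fun B H => sz B (mem_behead (s := A :: s) H)) (andP un).2
  (fun B C HB HC => disj B C (mem_behead (s := A :: s) HB) (mem_behead (s := A :: s) HC)).
set Bad := neg (acc_set Z) :\: _ in IH *.
rewrite big_cons /=; set Bad' := _ :\: _.
(* Outside the core, [u] belongs to no other member of the sunflower, so recolouring it does not
   affect the remaining conditions. This replaces independence. *)
have stab u c y : u \in A -> u \notin Z -> c \in Bad -> upd c u y \in Bad.
  move=> uA uZ; rewrite !in_setD => /andP[Hs HZ].
  have updE (B : {set T}) : u \notin B ->
      (upd c u y \in neg (acc_set B)) = (c \in neg (acc_set B)).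
    move=> uB; have ne v : v \in B -> (v == u) = false.
      by move=> vB; apply: contraNF uB => /eqP <-.
    rewrite !mem_neg; apply/inr_acc_setP/inr_acc_setP => H v w vB wB;
      by move: (H v w vB wB); rewrite !ffunE !ne.
  rewrite updE // HZ andbT; apply: contra Hs; rewrite !bigcup_seq => /bigcupP[B Bs].
  rewrite updE => [HB|]; first by apply/bigcupP; exists B.
  apply: contra uZ => uB.
  have neAB : A != B by apply: contraTneq Bs => <-; have /andP[] := un.
  have /subsetP := disj A B (mem_head _ _) (mem_behead (s := A :: s) Bs) neAB.
  by apply; rewrite inE uA uB.
have step : #|Bad'| * k <= l ^ 2 * #|Bad|.
  apply: leq_trans (_ : \sum_(p in setX A A) #|Bad| <= _); last first.
    rewrite sum_nat_const cardsX leq_mul2r; apply/orP; right.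
    by rewrite -mulnn leq_mul // sz ?mem_head.
  pose C p := [set c in Bad | (c p.1 == c p.2) && ((p.1 != p.2) && (p.1 \notin Z))].
  have sub : Bad' \subset \bigcup_(p in setX A A) C p.
    apply/subsetP=> c; rewrite in_setD in_setU negb_or => /andP[/andP[HA Hs] HZ].
    have cB : c \in Bad by rewrite in_setD Hs.
    move: HA HZ; rewrite !mem_neg => HA /inr_acc_setP HZ.
    have [/existsP[[u w] /and5P[/= uA wA E ne out]]|no] :=
      boolP [exists p : T * T, [&& p.1 \in A, p.2 \in A, c p.1 == c p.2, p.1 != p.2 & p.1 \notin Z]].
      apply/bigcupP; exists (u, w); first by rewrite in_setX uA wA.
      by rewrite in_set cB /= E ne out.
    case/inr_acc_setP: HA => u w uA wA E; apply/eqP; apply: contraNT no => ne.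
    have [uZ|uZ] := boolP (u \in Z); last first.
      by apply/existsP; exists (u, w); rewrite /= uA wA E eqxx ne.
    apply/existsP; exists (w, u); rewrite /= uA wA E eqxx eq_sym ne /=.
    by apply: contraNN ne => wZ; apply/eqP/HZ.
  apply: leq_trans (_ : (\sum_(p in setX A A) #|C p|) * k <= _).
    rewrite leq_mul2r; apply/orP; right; apply: leq_trans (subset_leq_card sub) _.
    elim/big_rec2: _ => [|p m S _ le]; first by rewrite cards0.
    by apply: leq_trans (leq_add (leqnn _) le); apply: leq_card_setU.
  rewrite big_distrl; apply: leq_sum => -[u w]; rewrite inE /= => /andP[uA wA].
  have [/andP[ne uZ]|no] := boolP ((u != w) && (u \notin Z)); last first.
    by rewrite (_ : C _ = set0) ?cards0 //; apply/setP=> c; rewrite in_set in_set0 (negbTE no) !andbF.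
  rewrite (_ : C _ = [set c in Bad | c u == c w]); last first.
    by apply/setP=> c; rewrite !in_set ne uZ !andbT.
  by apply: card_neg_collision => // c y; apply: stab.
rewrite /= (expnS k) (expnS (l ^ 2)) mulnA; apply: leq_trans (leq_mul step (leqnn _)) _.
by rewrite -!mulnA !leq_mul2l IH !orbT.
Qed.

(** A random transversal contains [A] with probability at most [b ^ - #|A|]: each element fixes the
    choice in its block, and two elements in one block are incompatible. *)
Lemma card_pos_acc (A : {set T}) : #|pos (acc_set A)| * b ^ #|A| <= b ^ K.
Proof.
elim: {A}_.+1 {-2}A (ltnSn #|A|) => // N IH A.
have [->|[u uA]] := set_0Vmem A.
  rewrite cards0 muln1 => _; apply: leq_trans (max_card _) _.
  by rewrite card_ffun !card_ord.
rewrite (cardsD1 u) uA add1n expnS mulnA => lt.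
apply: leq_trans (IH (A :\ u) lt); rewrite leq_mul2r; apply/orP; right.
have [/existsP[w /and3P[wA ne E]]|no] := boolP [exists w, [&& w \in A, w != u & w.1 == u.1]].
  rewrite (_ : pos _ = set0) ?cards0 //; apply/setP=> f; rewrite mem_pos in_set0.
  apply/inl_acc_setP=> H; case/negP: ne; apply/eqP.
  rewrite [w]surjective_pairing [u]surjective_pairing -(H w) // -(H u) //.
  by rewrite (eqP E).
rewrite -[X in _ * X]card_ord -cardsT -cardsX.
rewrite -(card_in_imset (f := fun p => upd p.1 u.1 p.2)).
  apply/subset_leq_card/subsetP=> d /imsetP[[f y]].
  rewrite !inE /= andbT => /forall_inP H ->; apply/forall_inP => w.
  rewrite !inE ffunE => /andP[ne wA]; case: (w.1 =P u.1) => [E|_]; last exact: H.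
  by case/existsP: no; exists w; rewrite wA ne E eqxx.
move=> [f y] [f' y']; rewrite !in_setX !in_setT !andbT /= !mem_pos.
move=> /inl_acc_setP H /inl_acc_setP H'.
move/ffunP=> E; congr (_, _); last by have := E u.1; rewrite !ffunE eqxx.
apply/ffunP=> v; have := E v; rewrite !ffunE; case: eqP => // -> _.
by rewrite H ?H'.
Qed.

Local Notation NT := (k ^ #|{: T}|).
Local Notation small F := {in F, forall A : {set T}, #|A| <= l}.

Lemma mem_acc (F : {set {set T}}) x : reflect (exists2 A, A \in F & x \in acc_set A) (x \in acc F).
Proof. exact: bigcupP. Qed.

(** Each plucking replaces the [p] members of a sunflower by its core. As [p > 1] the family
    shrinks, so there are at most [#|F|] pluckings, each with the error of [card_neg_sunflower].
    Acceptance only grows, so no clique is lost. *)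
Lemma pluck p (F : {set {set T}}) : 1 < p -> small F ->
  exists F' : {set {set T}},
    [/\ small F', #|F'| <= (p * l) ^ l, acc F \subset acc F' &
        #|neg (acc F') :\: neg (acc F)| * k ^ p <= #|F| * ((l ^ 2) ^ p * NT)].
Proof.
move=> p_gt1; elim: {F}_.+1 {-2}F (ltnSn #|F|) => // N IH F ltN smallF.
have [leF|ltF] := leqP #|F| ((p * l) ^ l).
  by exists F; split; rewrite // setDv cards0.
have [Z [S [unS szS sSF ZS disjS]]] := sunflower (ltnW p_gt1) (leqnn l) smallF ltF.
pose F1 := Z |: (F :\: [set A in S]).
have smallZ : #|Z| <= l.
  have : 0 < size S by rewrite szS ltnW.
  case: (S) sSF ZS => // A S' sSF ZS _.
  apply: leq_trans (subset_leq_card (ZS A (mem_head _ _))) _.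
  by apply: smallF; apply: sSF; apply: mem_head.
have cardF1 : #|F1| < #|F|.
  rewrite cardsU1; apply: leq_ltn_trans (_ : 1 + #|F :\: [set A in S]| < _).
    by rewrite leq_add2r; case: (_ \notin _).
  rewrite -(cardsID [set A in S] F) add1n -add2n leq_add2r.
  have -> : F :&: [set A in S] = [set A in S].
    by apply/setIidPr/subsetP=> A; rewrite inE => /sSF.
  by rewrite cardsE (card_uniqP unS) szS.
have [||F' [smallF' cardF' accF' errF']] := IH F1.
- exact: leq_trans cardF1 ltN.
- by move=> A /setU1P[->|/setDP[AF _]] //; apply: smallF.
have accF1 : acc F \subset acc F1.
  apply/subsetP=> x /mem_acc[A AF xA]; apply/mem_acc.
  have [AS|AS] := boolP (A \in S).
    exists Z; first exact: setU11.
    by apply: subsetP xA; apply/acc_set_sub/ZS.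
  by exists A => //; rewrite in_setU1 in_setD inE AS AF orbT.
exists F'; split=> //; first exact: subset_trans accF'.
have smallS : {in S, forall A : {set T}, #|A| <= l} by move=> A /sSF/smallF.
have := card_neg_sunflower smallS unS disjS; rewrite szS.
set Bad := _ :\: _ => errZ.
apply: leq_trans (_ : (#|Bad| + #|neg (acc F') :\: neg (acc F1)|) * k ^ p <= _).
  rewrite leq_mul2r; apply/orP; right.
  apply: leq_trans (leq_card_setU _ _); apply/subset_leq_card/subsetP=> c.
  rewrite in_setU !in_setD => /andP[cF ->]; rewrite andbT.
  have [|_] := boolP (c \in neg (acc F1)); rewrite ?orbT // ?orbF mem_neg.
  case/mem_acc=> A /setU1P[->|/setDP[AF _]] cA; last first.
    by case/negP: cF; rewrite mem_neg; apply/mem_acc; exists A.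
  rewrite mem_neg cA andbT; apply: contra cF; rewrite bigcup_seq.
  case/bigcupP=> B BS; rewrite !mem_neg => cB; apply/mem_acc; exists B => //.
  exact: sSF.
rewrite mulnDl; apply: leq_trans (leq_add errZ errF') _.
by rewrite -mulSn leq_mul2r cardF1 orbT.
Qed.

(** * Monotone straight-line programs and their approximation *)

Definition inputs : seq {set test} :=
  [:: set0, setT & [seq edge u w | u <- enum {: T}, w <- enum {: T}]].

Inductive slp : seq {set test} -> Prop :=
| slp_nil : slp [::]
| slp_and N g h : slp N -> g \in inputs ++ N -> h \in inputs ++ N -> slp (g :&: h :: N)
| slp_or N g h : slp N -> g \in inputs ++ N -> h \in inputs ++ N -> slp (g :|: h :: N).

(** [Ep] and [En] are meant to be shared by all functions of a program: errors inherited from the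
    arguments are then already included, and a gate adds only its own. *)
Definition approximated (Ep : {set {ffun 'I_K -> 'I_b}}) (En : {set {ffun T -> 'I_k}})
    (M : nat) (g : {set test}) :=
  exists A : {set {set T}}, [/\ small A, #|A| <= M,
    pos g :\: pos (acc A) \subset Ep & neg (acc A) :\: neg g \subset En].

Implicit Types (Ep : {set {ffun 'I_K -> 'I_b}}) (En : {set {ffun T -> 'I_k}}).

Lemma approximated_mono Ep En Ep' En' M g : Ep \subset Ep' -> En \subset En' ->
  approximated Ep En M g -> approximated Ep' En' M g.
Proof.
move=> sp sn [A [smA cA pA nA]]; exists A; split=> //.
  exact: subset_trans sp.
exact: subset_trans sn.
Qed.

Lemma approximated_input M g : 1 < l -> 0 < M -> g \in inputs ->
  approximated set0 set0 M g.
Proof.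
move=> l_gt1 M_gt0; have app0 : approximated set0 set0 M set0.
  exists set0; split; rewrite ?cards0 //.
  - by move=> A; rewrite inE.
  - by apply/subsetP=> f; rewrite !inE andbF.
  - by apply/subsetP=> c; rewrite /acc big_set0 !inE.
rewrite !inE => /or3P[/eqP->|/eqP->|/allpairsP[[u w] [_ _ ->]]] //=.
  exists [set set0]; split; rewrite ?cards1 //.
  - by move=> A; rewrite inE => /eqP->; rewrite cards0.
  - apply/subsetP=> f; rewrite in_setD mem_pos /acc big_set1 => /andP[/negP[]].
    by apply/inl_acc_setP => v; rewrite inE.
  - by apply/subsetP=> c; rewrite in_setD !mem_neg inE.
have [->|ne] := eqVneq u w.
  by rewrite (_ : edge w w = set0) //; apply/setP=> -[f|c]; rewrite !inE eqxx.
exists [set [set u; w]]; split; rewrite ?cards1 //.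
- by move=> A; rewrite inE => /eqP->; rewrite cards2 ne.
- apply/subsetP=> f; rewrite in_setD !mem_pos /acc big_set1 => /andP[/negP nf].
  rewrite inE => /and3P[_ /eqP fu /eqP fw]; case: nf.
  by apply/inl_acc_setP => v /set2P[]->.
- apply/subsetP=> c; rewrite in_setD !mem_neg /acc big_set1 => /andP[nc].
  move=> /inr_acc_setP H; case/negP: nc; rewrite inE.
  by apply: contra ne => /eqP E; apply/eqP; apply: H; rewrite ?set21 ?set22.
Qed.

Lemma slp_approximated p N : 1 < p -> 1 < l -> 0 < b -> slp N ->
  let M := (p * l) ^ l in
  exists Ep En, [/\ #|Ep| * b ^ l.+1 <= size N * (M ^ 2 * b ^ K),
    #|En| * k ^ p <= size N * (M ^ 2 * ((l ^ 2) ^ p * NT)) &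
    {in inputs ++ N, forall g, approximated Ep En M g}].
Proof.
move=> p_gt1 l_gt1 b_gt0 slpN M.
have M_gt1 : 1 < M.
  by apply: (ltn_trans l_gt1 (ltn_expl _ _)); apply: (leq_trans l_gt1); rewrite leq_pmull // ltnW.
have M_gt0 := ltnW M_gt1.
(* [H0] approximates the new gate before plucking, with fresh positive errors [Ep1]; plucking then
   contributes the fresh negative ones. *)
have gate N0 Ep En Ep1 g (H0 : {set {set T}}) :
    #|Ep| * b ^ l.+1 <= size N0 * (M ^ 2 * b ^ K) ->
    #|En| * k ^ p <= size N0 * (M ^ 2 * ((l ^ 2) ^ p * NT)) ->
    {in inputs ++ N0, forall g, approximated Ep En M g} ->
    small H0 -> #|H0| <= M ^ 2 -> #|Ep1| * b ^ l.+1 <= M ^ 2 * b ^ K ->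
    pos g :\: pos (acc H0) \subset Ep :|: Ep1 ->
    neg (acc H0) :\: neg g \subset En ->
    exists Ep' En', [/\ #|Ep'| * b ^ l.+1 <= size (g :: N0) * (M ^ 2 * b ^ K),
      #|En'| * k ^ p <= size (g :: N0) * (M ^ 2 * ((l ^ 2) ^ p * NT)) &
      {in inputs ++ g :: N0, forall g, approximated Ep' En' M g}].
  move=> leEp leEn app smallH leH leEp1 gp gn.
  have [H [smH cH accH errH]] := pluck p_gt1 smallH.
  set En1 := _ :\: _ in errH.
  exists (Ep :|: Ep1), (En :|: En1); split=> [||h].
  - rewrite /= mulSn addnC; apply: leq_trans (leq_add leEp leEp1).
    by rewrite -mulnDl leq_mul2r leq_card_setU orbT.
  - rewrite /= mulSn addnC.
    apply: leq_trans (leq_add leEn (leq_trans errH (leq_mul leH (leqnn _)))).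
    by rewrite -mulnDl leq_mul2r leq_card_setU orbT.
  - rewrite mem_cat (in_cons g) orbCA -mem_cat => /predU1P[->|/app]; last first.
      by apply: approximated_mono; apply: subsetUl.
    exists H; split=> //.
      apply: subset_trans gp; apply: setDS; apply/subsetP=> f; rewrite !mem_pos.
      exact: (subsetP accH).
    apply/subsetP=> c /setDP[cH' cg]; rewrite in_setU.
    have [c0|c0] := boolP (c \in neg (acc H0)).
      by rewrite (subsetP gn) // in_setD cg c0.
    by rewrite [c \in En1]in_setD c0 cH' orbT.
elim: slpN => [|{}N g h _ [Ep [En [leEp leEn app]]] gN hN|{}N g h _ [Ep [En [leEp leEn app]]] gN hN].
- exists set0, set0; rewrite !cards0; split=> // g; rewrite cats0.
  exact: approximated_input.
- have [A [smA cA pA nA]] := app _ gN; have [B [smB cB pB nB]] := app _ hN.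
  (* Unions larger than [l] are discarded. There are at most [M ^ 2] of them, and each loses at most
     a [b ^ - l.+1] fraction of the cliques. *)
  pose H0 := [set C in [set a :|: d | a in A, d in B] | #|C| <= l].
  pose H1 := [set C in [set a :|: d | a in A, d in B] | l < #|C|].
  have cAB : #|[set a :|: d | a in A, d in B]| <= M ^ 2.
    rewrite curry_imset2X; apply: leq_trans (leq_imset_card _ _) _.
    by rewrite cardsX -mulnn leq_mul.
  apply: (gate _ _ _ (\bigcup_(C in H1) pos (acc_set C)) _ H0 leEp leEn app).
  + by move=> C; rewrite inE => /andP[].
  + apply: leq_trans cAB; apply/subset_leq_card/subsetP=> C.
    by rewrite inE => /andP[].
  + apply: leq_trans (_ : #|H1| * b ^ K <= _); last first.
      rewrite leq_mul2r; apply/orP; right; apply: leq_trans cAB.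
      by apply/subset_leq_card/subsetP=> C; rewrite inE => /andP[].
    apply: leq_trans (_ : (\sum_(C in H1) #|pos (acc_set C)|) * b ^ l.+1 <= _).
      rewrite leq_mul2r; apply/orP; right.
      elim/big_rec2: _ => [|C m S _ le]; first by rewrite cards0.
      by apply: leq_trans (leq_add (leqnn _) le); apply: leq_card_setU.
    rewrite big_distrl -sum_nat_const; apply: leq_sum => C; rewrite inE => /andP[_ ltC].
    apply: leq_trans (card_pos_acc C); rewrite leq_mul2l; apply/orP; right.
    by rewrite leq_pexp2l.
  + apply/subsetP=> f /setDP[]; rewrite mem_pos => /setIP[fg fh] fH.
    rewrite in_setU; have [//|fE] := boolP (f \in Ep).
    have inE' (g' : {set test}) (A' : {set {set T}}) :
        inl f \in g' -> pos g' :\: pos (acc A') \subset Ep -> inl f \in acc A'.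
      move=> fg' /subsetP/(_ f); rewrite in_setD !mem_pos fg' andbT.
      by case: (inl f \in acc A') => // /(_ isT); rewrite (negbTE fE).
    have /mem_acc[a aA fa] := inE' _ _ fg pA; have /mem_acc[d dB fd] := inE' _ _ fh pB.
    have fad : inl f \in acc_set (a :|: d).
      by apply/inl_acc_setP => u /setUP[]; [apply: (inl_acc_setP _ _ fa) | apply: (inl_acc_setP _ _ fd)].
    have adX : a :|: d \in [set a :|: d | a in A, d in B] by apply: imset2_f.
    apply/bigcupP; exists (a :|: d); last by rewrite mem_pos.
    rewrite inE adX /= ltnNge; apply: contra fH => le; rewrite mem_pos.
    by apply/mem_acc; exists (a :|: d); rewrite // inE adX.
  + apply/subsetP=> c /setDP[]; rewrite mem_neg => /mem_acc[C].
    rewrite inE => /andP[/imset2P[a d aA dB ->] _] cad.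
    have ca : c \in neg (acc A).
      rewrite mem_neg; apply/mem_acc; exists a => //.
      exact: subsetP (acc_set_sub (subsetUl a d)) _ cad.
    have cd : c \in neg (acc B).
      rewrite mem_neg; apply/mem_acc; exists d => //.
      exact: subsetP (acc_set_sub (subsetUr a d)) _ cad.
    rewrite mem_neg in_setI negb_and -!mem_neg => /orP[] nc.
      by apply: (subsetP nA); rewrite in_setD nc.
    by apply: (subsetP nB); rewrite in_setD nc.
- have [A [smA cA pA nA]] := app _ gN; have [B [smB cB pB nB]] := app _ hN.
  apply: (gate _ _ _ set0 _ (A :|: B) leEp leEn app).
  + by move=> C /setUP[]; [apply: smA | apply: smB].
  + apply: leq_trans (leq_card_setU _ _) _; apply: leq_trans (leq_add cA cB) _.
    by rewrite addnn -mul2n -mulnn leq_mul2r M_gt1 orbT.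
  + by rewrite cards0.
  + rewrite setU0; apply/subsetP=> f /setDP[]; rewrite mem_pos => fgh.
    rewrite mem_pos /acc bigcup_setU in_setU negb_or => /andP[fA fB].
    case/setUP: fgh => ?; [apply: (subsetP pA) | apply: (subsetP pB)];
      by rewrite in_setD !mem_pos; apply/andP.
  + apply/subsetP=> c /setDP[]; rewrite !mem_neg /acc bigcup_setU.
    rewrite !in_setU negb_or => cAB /andP[cg ch].
    case/orP: cAB => ?; [apply: (subsetP nA) | apply: (subsetP nB)];
      by rewrite in_setD !mem_neg; apply/andP.
Qed.

(** A circuit given by the set [U] of functions that its gates may compute. No order or sharing has
    to be described: a program without repetitions has at most [size U] gates. *)
Inductive gated (U : seq {set test}) : {set test} -> Prop :=
| gated_input g : g \in inputs -> gated U g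
| gated_and g h : g :&: h \in U -> gated U g -> gated U h -> gated U (g :&: h)
| gated_or g h : g :|: h \in U -> gated U g -> gated U h -> gated U (g :|: h).

Lemma gated_slp U g : gated U g -> forall N, slp N -> uniq N -> {subset N <= U} ->
  exists N', [/\ slp N', uniq N', {subset N' <= U}, {subset N <= N'} & g \in inputs ++ N'].
Proof.
have add N g' : slp (g' :: N) -> slp N -> uniq N -> {subset N <= U} -> g' \in U ->
    exists N', [/\ slp N', uniq N', {subset N' <= U}, {subset N <= N'} & g' \in inputs ++ N'].
  move=> slpg slpN uN sNU gU; have [gN|gN] := boolP (g' \in N).
    by exists N; split; rewrite // mem_cat gN orbT.
  exists (g' :: N); split=> //.
  - by rewrite /= gN.
  - by move=> h /predU1P[->|/sNU].
  - by move=> h hN; rewrite in_cons hN orbT.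
  - by rewrite mem_cat mem_head orbT.
have sub (N1 N2 : seq {set test}) g' : {subset N1 <= N2} -> g' \in inputs ++ N1 -> g' \in inputs ++ N2.
  by move=> sN; rewrite !mem_cat => /orP[->//|/sN->]; rewrite orbT.
elim=> {g} [g gi|g h ghU _ IHg _ IHh|g h ghU _ IHg _ IHh] N slpN uN sNU.
- by exists N; split; rewrite // mem_cat gi.
- have [N1 [slp1 u1 sU1 s1 g1]] := IHg N slpN uN sNU.
  have [N2 [slp2 u2 sU2 s2 h2]] := IHh N1 slp1 u1 sU1.
  have [N3 [slp3 u3 sU3 s3 gh3]] :=
    add _ _ (slp_and slp2 (sub _ _ _ s2 g1) h2) slp2 u2 sU2 ghU.
  by exists N3; split=> // f /s1/s2/s3.
- have [N1 [slp1 u1 sU1 s1 g1]] := IHg N slpN uN sNU.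
  have [N2 [slp2 u2 sU2 s2 h2]] := IHh N1 slp1 u1 sU1.
  have [N3 [slp3 u3 sU3 s3 gh3]] :=
    add _ _ (slp_or slp2 (sub _ _ _ s2 g1) h2) slp2 u2 sU2 ghU.
  by exists N3; split=> // f /s1/s2/s3.
Qed.

(** An empty final approximator rejects every clique, so all cliques are errors. A nonempty one
    contains some [C] with at most [l] vertices, on which at least half of the colourings are
    injective, and all of these are errors. *)
Lemma monotone_lower_bound p U g : 1 < p -> 1 < l -> 0 < b -> 0 < k -> 2 * l ^ 2 <= k ->
  gated U g -> pos g = setT -> neg g = set0 ->
  let M := (p * l) ^ l in
  b ^ l.+1 <= size U * M ^ 2 \/ k ^ p <= 2 * (size U * M ^ 2) * (l ^ 2) ^ p.
Proof.
move=> p_gt1 l_gt1 b_gt0 k_gt0 le2k cg pg ng M.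
have [N [slpN uN sNU _ gN]] := gated_slp cg slp_nil isT (fun _ H => False_ind _ (notF H)).
have leN : size N <= size U by apply: uniq_leq_size.
have [Ep [En [leEp leEn /(_ g gN)[A [smA cA pA nA]]]]] := slp_approximated p_gt1 l_gt1 b_gt0 slpN.
have NT_gt0 : 0 < NT by rewrite expn_gt0 k_gt0.
have [E|[C CA]] := set_0Vmem A; [left|right].
  have bK : b ^ K <= #|Ep|.
    apply: leq_trans (subset_leq_card pA).
    rewrite pg E /acc big_set0 (_ : pos set0 = set0) ?setD0 ?cardsT ?card_ffun ?card_ord //.
    by apply/setP=> f; rewrite !inE.
  rewrite -(leq_pmul2l (m := b ^ K)) ?expn_gt0 ?b_gt0 //.
  apply: leq_trans (leq_mul bK (leqnn _)) _; apply: leq_trans leEp _.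
  by rewrite mulnA mulnC leq_mul2l leq_mul2r leN !orbT.
have leNT : NT <= 2 * #|En|.
  have sz1 : {in [:: C], forall A : {set T}, #|A| <= l} by move=> D; rewrite inE => /eqP->; apply: smA.
  have disj1 : {in [:: C] &, forall A B : {set T}, A != B -> A :&: B \subset set0}.
    by move=> D D'; rewrite !mem_seq1 => /eqP-> /eqP->; rewrite eqxx.
  (* A sunflower with one member and empty core: [C] has a collision with probability at most
     [l ^ 2 / k], hence at most one half. *)
  have := card_neg_sunflower sz1 isT disj1; rewrite /= !expn1 big_seq1.
  have -> : neg (acc_set set0) = setT.
    by apply/setP=> c; rewrite mem_neg in_setT; apply/inr_acc_setP => u; rewrite inE.
  rewrite setTD => le.
  have leC : #|neg (acc_set C)| <= #|En|.
    apply: subset_leq_card; apply: subset_trans nA; rewrite ng setD0.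
    by apply/subsetP=> c; rewrite !mem_neg => cC; apply/mem_acc; exists C.
  have half : 2 * #|~: neg (acc_set C)| <= NT.
    rewrite -(leq_pmul2l k_gt0); apply: leq_trans (_ : 2 * (l ^ 2 * NT) <= _).
      by rewrite mulnCA leq_mul2l [k * _]mulnC le.
    by rewrite mulnA leq_mul2r le2k orbT.
  have := cardsC (neg (acc_set C)); rewrite card_ffun card_ord.
  move: leC half; set x := #|_|; set y := #|_|; set z := _ ^ _; set w := #|_|; lia.
rewrite -(leq_pmul2l NT_gt0); apply: leq_trans (leq_mul leNT (leqnn _)) _.
rewrite -mulnA; apply: leq_trans (leq_mul (leqnn 2) leEn) _.
rewrite [NT * _]mulnC -!mulnA leq_mul2l /=.
by apply: leq_mul leN _; rewrite !mulnA.
Qed.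

End LowerBound.

(** * The circuit of a proof *)

Lemma mem_bigcap_seq (X : finType) (s : seq {set X}) x :
  (x \in \bigcap_(h <- s) h) = all (fun h : {set X} => x \in h) s.
Proof. by elim: s => [|g s IH]; rewrite ?big_nil ?big_cons !inE //= IH. Qed.

Lemma mem_bigcup_seq (X : finType) (s : seq {set X}) x :
  (x \in \bigcup_(h <- s) h) = has (fun h : {set X} => x \in h) s.
Proof. by elim: s => [|g s IH]; rewrite ?big_nil ?big_cons !inE //= IH. Qed.

Lemma size_flatten_leq (A B : eqType) (s : seq A) (F : A -> seq B) m :
  {in s, forall x, size (F x) <= m} -> size (flatten [seq F x | x <- s]) <= size s * m.
Proof.
elim: s => //= x s IH H; rewrite size_cat mulSn leq_add ?H ?mem_head //.
by apply: IH => y ys; apply: H; rewrite inE ys orbT.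
Qed.

Section ClosureCircuit.

Variables (K b k : nat) (V : choiceType).
Variables (Cl : seq (clause V)) (Dc : seq (formula V)).

Local Notation test := ({ffun 'I_K -> 'I_b} + {ffun 'I_K * 'I_b -> 'I_k})%type.

Variable a : test -> V -> bool.
Hypothesis a_input : forall x, [set t | a t x] \in inputs K b k.

Implicit Types (s : seq {set test}) (f : formula V) (c : clause V).

Definition val_set t f : {set test} := [set x | value Cl Dc (a x) t f].

Lemma mem_val_set t f x : (x \in val_set t f) = value Cl Dc (a x) t f.
Proof. by rewrite inE. Qed.

(** The partial intersections, one per suffix: the binary gates of an iterated conjunction. *)
Fixpoint caps s := if s is _ :: s' then \bigcap_(h <- s) h :: caps s' else [::].
Fixpoint cups s := if s is _ :: s' then \bigcup_(h <- s) h :: cups s' else [::].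

(** Removing duplicates makes the fan-in independent of the number of formulas in the context of the
    line. *)
Definition prem_sets t c := undup [seq val_set t f | f <- c.1].
Definition fire_set t c := \bigcap_(h <- prem_sets t c) h.
Definition fire_sets t f := [seq fire_set t c | c <- Cl & chead c == f].

Definition level t : seq {set test} :=
  [seq val_set t f | f <- Dc] ++ flatten [seq caps (prem_sets t c) | c <- Cl] ++
  flatten [seq cups (fire_sets t (chead c)) | c <- Cl].

Definition gates := flatten [seq level t | t <- iota 0 (size Cl).+1].

Lemma size_caps s : size (caps s) = size s. Proof. by elim: s => //= g s ->. Qed.
Lemma size_cups s : size (cups s) = size s. Proof. by elim: s => //= g s ->. Qed.

Lemma size_inputs : size (inputs K b k) = (2 + (K * b) ^ 2).
Proof. by rewrite /= size_allpairs -!cardE card_prod !card_ord mulnn. Qed.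

Lemma gated_caps U s : {in s, forall g, gated U g} -> {subset caps s <= U} ->
  gated U (\bigcap_(h <- s) h).
Proof.
elim: s => [|g s IH] gs sU.
  by rewrite big_nil; apply: gated_input; rewrite !inE eqxx orbT.
have gU : \bigcap_(h <- g :: s) h \in U by apply: sU; apply: mem_head.
rewrite big_cons in gU *; apply: gated_and gU _ _; first by apply: gs; apply: mem_head.
apply: IH => [h hs|h hs]; [apply: gs | apply: sU]; by rewrite in_cons hs orbT.
Qed.

Lemma gated_cups U s : {in s, forall g, gated U g} -> {subset cups s <= U} ->
  gated U (\bigcup_(h <- s) h).
Proof.
elim: s => [|g s IH] gs sU.
  by rewrite big_nil; apply: gated_input; rewrite !inE eqxx.
have gU : \bigcup_(h <- g :: s) h \in U by apply: sU; apply: mem_head.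
rewrite big_cons in gU *; apply: gated_or gU _ _; first by apply: gs; apply: mem_head.
apply: IH => [h hs|h hs]; [apply: gs | apply: sU]; by rewrite in_cons hs orbT.
Qed.

Lemma mem_fire_set t c x : (x \in fire_set t c) = all (value Cl Dc (a x) t) c.1.
Proof.
rewrite mem_bigcap_seq (eq_all_r (s2 := [seq val_set t f | f <- c.1])); last exact: mem_undup.
by rewrite all_map; apply: eq_all => f /=; rewrite inE.
Qed.

Lemma val_set_impS t f g :
  val_set t.+1 (Imp f g) = \bigcup_(h <- fire_sets t (Imp f g)) h.
Proof.
apply/setP=> x; rewrite inE mem_bigcup_seq has_map has_filter -filter_predI -has_filter.
apply/value_impP/hasP => [[i]|[c cCl /andP[/= xc /eqP E]]].
  rewrite mem_stageS => prem E; exists (tnth (in_tuple Cl) i).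
    exact: (mem_tnth i (in_tuple Cl)).
  by rewrite /= mem_fire_set prem E eqxx.
have /tnthP[i Ei] : c \in in_tuple Cl by [].
by exists i; rewrite -?Ei // mem_stageS -Ei -mem_fire_set.
Qed.

Lemma val_set0 t f : val_set t f = set0 -> val_set t f \in inputs K b k.
Proof. by move->; rewrite inE eqxx. Qed.

Lemma val_set_notin t f : f \notin Dc -> (forall g h, f <> Imp g h) ->
  val_set t f \in inputs K b k.
Proof.
case: f => [x|g h|g h|g h||] fD nimp.
- exact: a_input.
- by apply: val_set0; apply/setP=> x; rewrite !inE /value /= (negbTE fD).
- by apply: val_set0; apply/setP=> x; rewrite !inE /value /= (negbTE fD).
- by case: (nimp g h).
- have -> : val_set t Top = setT by apply/setP=> x; rewrite !inE.
  by rewrite !inE eqxx orbT.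
- by apply: val_set0; apply/setP=> x; rewrite !inE.
Qed.

(** Outside [Dc] a formula is an input, a constant, or an implication, and an implication that heads
    no clause is false. So a stage has few distinct functions, however many formulas occur in the
    proof. *)
Lemma mem_vals t f : val_set t f \in
  inputs K b k ++ [seq val_set t g | g <- Dc] ++ [seq val_set t (chead c) | c <- Cl].
Proof.
rewrite !mem_cat.
have [fD|fD] := boolP (f \in Dc); first by rewrite map_f ?orbT.
case: f fD => [x|g h|g h|g h||] fD; try by rewrite val_set_notin.
have [/hasP[c cCl /eqP <-]|none] := boolP (has (fun c => chead c == Imp g h) Cl).
  by rewrite (map_f (fun c => val_set t (chead c))) ?orbT.
rewrite val_set0 //; apply/setP=> x; rewrite !inE.
apply/value_impP=> -[i _ E]; case/hasP: none; exists (tnth (in_tuple Cl) i).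
  exact: (mem_tnth i (in_tuple Cl)).
by rewrite E.
Qed.

Lemma size_level t :
  size (level t) <= size Dc + size Cl * (size (inputs K b k) + (size Dc + size Cl))
                    + size Cl * size Cl.
Proof.
rewrite !size_cat size_map -addnA leq_add2l; apply: leq_add; apply: size_flatten_leq => c _.
  rewrite size_caps -[X in _ <= _ + X](_ : size ([seq val_set t g | g <- Dc] ++
     [seq val_set t (chead c) | c <- Cl]) = _); last by rewrite size_cat !size_map.
  rewrite -size_cat; apply: uniq_leq_size; first exact: undup_uniq.
  by move=> g; rewrite mem_undup => /mapP[f _ ->]; apply: mem_vals.
by rewrite size_cups size_map size_filter count_size.
Qed.

Lemma size_gates : size gates <= (size Cl).+1 *
  (size Dc + size Cl * (size (inputs K b k) + (size Dc + size Cl)) + size Cl * size Cl).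
Proof.
rewrite -[X in _ <= X * _](size_iota 0); apply: size_flatten_leq => t _.
exact: size_level.
Qed.

Lemma level_gates t : t <= size Cl -> {subset level t <= gates}.
Proof.
by move=> le g gl; apply/flattenP; exists (level t) => //; apply: map_f; rewrite mem_iota.
Qed.

Lemma gated_val_set_stage t f : t <= size Cl ->
  (forall g h, gated gates (val_set t (Imp g h))) -> gated gates (val_set t f).
Proof.
move=> le gated_imp.
have mem_gates g : g \in Dc -> val_set t g \in gates.
  by move=> gD; apply: (level_gates le); rewrite mem_cat map_f.
elim: f => [x|g IHg h IHh|g IHg h IHh|g _ h _||].
all: try by apply: gated_imp.
- exact/gated_input/a_input.
- have [D|D] := boolP (And g h \in Dc); last exact/gated_input/val_set_notin.
  have E : val_set t (And g h) = val_set t g :&: val_set t h.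
    by apply/setP=> x; rewrite !inE /value /= D.
  by rewrite E; apply: gated_and; rewrite // -E mem_gates.
- have [D|D] := boolP (Or g h \in Dc); last exact/gated_input/val_set_notin.
  have E : val_set t (Or g h) = val_set t g :|: val_set t h.
    by apply/setP=> x; rewrite !inE /value /= D.
  by rewrite E; apply: gated_or; rewrite // -E mem_gates.
- have -> : val_set t Top = setT by apply/setP=> x; rewrite !inE.
  by apply: gated_input; rewrite !inE eqxx orbT.
- have -> : val_set t Bot = set0 by apply/setP=> x; rewrite !inE.
  by apply: gated_input; rewrite !inE eqxx.
Qed.

Lemma gated_val_set t f : t <= size Cl -> gated gates (val_set t f).
Proof.
elim: t f => [|t IHt] f le; apply: gated_val_set_stage => // g h.
  apply/gated_input/val_set0/setP=> x; rewrite !inE.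
  by apply/value_impP=> -[i]; rewrite inE.
have {}le : t <= size Cl by apply: ltnW.
have [/hasP[c cCl /eqP <-]|none] := boolP (has (fun c => chead c == Imp g h) Cl).
  rewrite val_set_impS; apply: gated_cups => [_ /mapP[d + ->]|u uc].
    rewrite mem_filter => /andP[_ dCl]; apply: gated_caps => [u|u uc].
      by rewrite mem_undup => /mapP[f' _ ->]; apply: IHt.
    apply: (level_gates le); rewrite !mem_cat; apply/or3P; constructor 2.
    by apply/flattenP; exists (caps (prem_sets t d)) => //; apply: map_f.
  apply: (level_gates le); rewrite !mem_cat; apply/or3P; constructor 3.
  by apply/flattenP; exists (cups (fire_sets t (chead c))) => //; apply: map_f.
rewrite val_set_impS /fire_sets (_ : [seq c <- Cl | _] = [::]).
  by rewrite big_nil; apply: gated_input; rewrite !inE eqxx.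
by apply/eqP; rewrite -(negbK (_ == _)) -has_filter.
Qed.

End ClosureCircuit.

Lemma fsize_bigfus (s : seq (fl_formula var)) m :
  all (fun f => fsize (transl f) <= m) s ->
  fsize (transl (bigfus s)) <= (size s * m.+1).+1.
Proof.
case: s => [|x s] //= /andP[lex les]; rewrite /bigfus /=.
suff H M y : fsize (transl y) <= M ->
    fsize (transl (foldl (@FFus var) y s)) <= M + size s * m.+1.
  by have := H _ _ lex; rewrite mulSn; lia.
elim: s les M y => [|z s IH] /= les M y ley; first by rewrite addn0.
by case/andP: les => lez les; rewrite mulSn addnA; apply: IH => //=; lia.
Qed.

(** * Cliques and coloured graphs as valuations *)

Section Separator.

Variables (n k b : nat).
Hypothesis Kb_n : k.+1 * b <= n.

Local Notation K := k.+1.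
Local Notation T := ('I_K * 'I_b)%type.
Local Notation test := ({ffun 'I_K -> 'I_b} + {ffun T -> 'I_k})%type.

Definition node (u : T) : nat := u.1 * b + u.2.
Definition vertex (i : nat) : option T := [pick u | node u == i].

Lemma node_inj : injective node.
Proof.
move=> [i j] [i' j'] E; have b_gt0 : 0 < b by apply: leq_ltn_trans (ltn_ord j).
congr (_, _); apply: val_inj => /=.
  by have := congr1 (divn^~ b) E; rewrite /node /= !divnMDl // !divn_small // !addn0.
by have := congr1 (modn^~ b) E; rewrite /node /= !modnMDl !modn_small.
Qed.

Lemma node_ltn u : node u < n.
Proof.
apply: leq_trans Kb_n; rewrite /node.
apply: leq_trans (_ : u.1 * b + b <= _); first by rewrite ltn_add2l.
by rewrite -mulSnr leq_mul2r ltn_ord orbT.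
Qed.

Lemma vertex_node u : vertex (node u) = Some u.
Proof.
by rewrite /vertex; case: pickP => [w /eqP/node_inj->|/(_ u)] //; rewrite eqxx.
Qed.

(** The blocks occupy the first [K * b] vertices; the others are isolated. *)
Definition adj (x : test) (i j : nat) : bool :=
  if (vertex i, vertex j) is (Some u, Some w) then x \in edge k u w else false.

Lemma adj_node x u w : adj x (node u) (node w) = (x \in edge k u w).
Proof. by rewrite /adj !vertex_node. Qed.

Definition graph_val (x : test) (v : var) : bool :=
  match v with vp i j => adj x i j | vq _ _ => true | _ => false end.

Lemma graph_val_input v : [set x | graph_val x v] \in inputs K b k.
Proof.
have in0 (A : {set test}) : A = set0 -> A \in inputs K b k by move->; rewrite inE eqxx.
case: v => i j /=; try by apply: in0; apply/setP=> x; rewrite !inE.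
  rewrite /adj; case: (vertex i) => [u|]; last by apply: in0; apply/setP=> x; rewrite !inE.
  case: (vertex j) => [w|]; last by apply: in0; apply/setP=> x; rewrite !inE.
  rewrite (_ : [set _ | _] = edge k u w); last by apply/setP=> x; rewrite inE.
  rewrite !in_cons; apply/or3P; constructor 3; apply/allpairsP; exists (u, w).
  by rewrite !mem_enum.
rewrite (_ : [set _ | _] = setT); last by apply/setP=> x; rewrite !inE.
by rewrite !inE eqxx orbT.
Qed.

Definition clique_val (f : {ffun 'I_K -> 'I_b}) (v : var) : bool :=
  match v with
  | vp i j => adj (inl f) i j
  | vq i j => ~~ adj (inl f) i j
  | vr i l => (l < K) && (i == node (inord l, f (inord l)))
  | vr' i l => ~~ ((l < K) && (i == node (inord l, f (inord l))))
  | _ => false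
  end.

(** A common lower bound of [graph_val], to which truth is raised by monotonicity, and of
    [clique_val], where [beta] fails. Taking [q] as the complement of [p] still satisfies the
    antecedent of the end sequent. *)
Definition edge_val (f : {ffun 'I_K -> 'I_b}) (v : var) : bool :=
  match v with
  | vp i j => adj (inl f) i j
  | vq i j => ~~ adj (inl f) i j
  | _ => false
  end.

Lemma clique_val_beta f : ~~ ceval (clique_val f) (transl (beta n K)).
Proof.
apply/ceval_betaP=> -[[l ltl /(_ (node (inord l, f (inord l)))) /=]|].
  by rewrite node_ltn ltl eqxx => /(_ isT).
case=> i [j [l [m [lti ltj ltlm ltm [/= /andP[_ /eqP->] /andP[_ /eqP->]]]]]].
rewrite adj_node inE xpair_eqE !eqxx !andbT negbK => /andP[/eqP/(congr1 val)].
by rewrite /= !inordK ?(ltn_trans ltlm) // => E; rewrite E ltnn in ltlm.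
Qed.

(** Isolated vertices receive colour 0, which is a legitimate colour once [0 < k]. *)
Definition colour_of (c : {ffun T -> 'I_k}) (i : nat) : nat :=
  if vertex i is Some u then c u else 0.

Definition colour_val (c : {ffun T -> 'I_k}) (v : var) : bool :=
  match v with
  | vp i j => adj (inr c) i j
  | vq _ _ => true
  | vs i l => colour_of c i == l
  | vs' i l => colour_of c i != l
  | _ => false
  end.

Lemma colour_val_alpha c : 0 < k -> ~~ ceval (colour_val c) (transl (alpha n k)).
Proof.
move=> k_gt0; apply/ceval_alphaP=> -[[i lti /(_ (colour_of c i))]|].
  rewrite /= eqxx /colour_of; case: (vertex i) => [u|] H; last by have := H k_gt0.
  by have := H (ltn_ord _).
case=> i [j [l [lti ltj ltl [/= /eqP<- /eqP E]]]]; rewrite /adj.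
move: E; rewrite /colour_of; case: (vertex i) => // u; case: (vertex j) => // w E.
by rewrite inE (_ : c u = c w) ?eqxx //; apply: val_inj.
Qed.

Lemma separator_of_proof (pi : seq (sequent var)) : 0 < k -> 0 < n ->
  bpc_proof (mset0, [mset transl (Theta_nk n k)])%mset pi ->
  exists (U : seq {set test}) (g : {set test}),
    [/\ gated U g, pos g = setT, neg g = set0 & size U <= 66 * size pi ^ 3 * n ^ 2].
Proof.
move=> k_gt0 n_gt0 [der [pi0 Epi]].
have [Cl [Dc0 [szCl szDc0 Hpi sound]]] := derivation_clauses der.
pose P := transl (bigfus [seq choice1 (vp i j) (vq i j) | i <- iota 0 n, j <- iota 0 n]).
pose SA := transl (FUnder
  (bigfus [seq choice1 (vs i l) (vs' i l) | i <- iota 0 n, l <- iota 0 k]) (alpha n k)).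
pose RB := transl (FUnder
  (bigfus [seq choice1 (vr i l) (vr' i l) | i <- iota 0 n, l <- iota 0 K]) (beta n K)).
(* The antecedent must evaluate to its classical value and the disjunction must split, so both are
   analysed too. *)
pose Dc := Dc0 ++ Or SA RB :: subf P.
have szDc : size Dc <= 4 * size pi + (8 * n ^ 2).+2.
  rewrite size_cat leq_add //= ltnS; apply: leq_trans (size_subf _) _.
  have sz : fsize P <= (n ^ 2 * 8).+1.
    rewrite -mulnn -(_ : size [seq choice1 (vp i j) (vq i j)
      | i <- iota 0 n, j <- iota 0 n] = n * n); last by rewrite size_allpairs size_iota.
    by apply: fsize_bigfus; rewrite all_allpairs_dep; do 2!apply/allP=> ? _.
  by rewrite mulnC.
pose L := size Cl.
exists (gates Cl Dc graph_val), (val_set Cl Dc graph_val L SA); split.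
- by apply: gated_val_set => //; apply: graph_val_input.
- apply/setP=> f; rewrite in_setT mem_pos mem_val_set.
  have lea v : edge_val f v -> graph_val (inl f) v by case: v.
  apply: value_mono lea _.
  have sD : {subset Dc0 <= Dc} by move=> u uD; rewrite mem_cat uD.
  have [lines mp] := Hpi Dc _ _ sD (closed_value (a := edge_val f)).
  have vP : value Cl Dc (edge_val f) L P.
    rewrite /value ev_imp_free ?imp_free_choices //; last first.
      by move=> u uP; rewrite mem_cat in_cons uP !orbT.
    by apply/ceval_choicesP=> i j _ _ /=; case: adj.
  have vD : value Cl Dc (edge_val f) L (Or SA RB).
    apply: value_mp vP => //.
    have [||u] := lines (mset0, [mset transl (Theta_nk n k)])%mset; rewrite /= ?in_mset1.
    + by rewrite Epi mem_rcons mem_head.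
    + by move=> u; rewrite in_mset0.
    + by move=> /eqP->.
  have : value Cl Dc (edge_val f) L SA || value Cl Dc (edge_val f) L RB.
    by move: vD; rewrite /value /= => /andP[].
  case/orP=> // vRB.
  have ler v : edge_val f v -> clique_val f v by case: v.
  have : _ ==> ceval (clique_val f) (transl (beta n K)) := value_sound (sound _).1 ler vRB.
  rewrite (negbTE (clique_val_beta f)) implybF => /negP[].
  by apply/ceval_choicesP=> i l _ ltl /=; case: (_ && _).
- apply/setP=> c; rewrite in_set0 mem_neg mem_val_set; apply: negbTE; apply/negP=> vSA.
  (* [alpha] does not mention the variables [q], so it remains refuted when all of them are true. *)
  have les v : graph_val (inr c) v -> colour_val c v by case: v.
  have : _ ==> ceval (colour_val c) (transl (alpha n k)) := value_sound (sound _).1 les vSA.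
  rewrite (negbTE (colour_val_alpha _ k_gt0)) implybF => /negP[].
  by apply/ceval_choicesP=> i l _ ltl /=; case: (_ == _).
- apply: leq_trans (size_gates Cl Dc graph_val_input) _; rewrite size_inputs.
  have s_gt0 : 0 < size pi by rewrite Epi size_rcons.
  have leKb : (K * b) ^ 2 <= n ^ 2 by rewrite leq_sqr.
  have n2 : 0 < n ^ 2 by rewrite expn_gt0 n_gt0.
  move: szDc szCl leKb n2 s_gt0.
  set d := size Dc; set N := (K * b) ^ 2; set m := n ^ 2; set s := size pi.
  rewrite -/L => szDc szCl leKb m_gt0 s_gt0.
  have sm : s <= s * m by rewrite leq_pmulr.
  have ms : m <= s * m by rewrite leq_pmull.
  (* Since [s] and [m] are positive, each term is at most its coefficient times [s * m]: here 4 + 8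
     + 2, next 2 + 1 + 14 + 1. Finally 14 + 18 + 1 = 33, doubled by the number of stages. *)
  have led : d <= 14 * (s * m) by lia.
  have leX : 2 + N + (d + L) <= 18 * (s * m) by lia.
  apply: leq_trans (_ : (2 * s) * (14 * (s * m) + s * (18 * (s * m)) + s * s) <= _).
    by apply: leq_mul; [lia | apply: leq_add; [apply: leq_add => // ; apply: leq_mul | apply: leq_mul]].
  have h1 : s * m <= s * (s * m) by rewrite leq_pmull.
  have h2 : s * s <= s * (s * m) by rewrite leq_mul2l sm orbT.
  have -> : 66 * s ^ 3 * m = 66 * (s * (s * (s * m))) by rewrite !expnS expn0; ring.
  have : 14 * (s * m) + s * (18 * (s * m)) + s * s <= 33 * (s * (s * m)) by lia.
  move/(leq_mul (leqnn (2 * s)))/leq_trans; apply.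
  by rewrite [leqLHS](_ : _ = 66 * (s * (s * (s * m)))) //; ring.
Qed.

End Separator.

(** * Choice of parameters *)

Lemma lines_lower_bound n l (pi : seq (sequent var)) :
  1 < l -> l ^ 16 <= n -> bpc_proof (Theta_sequent n) pi ->
  2 ^ l <= 132 * size pi ^ 3 * n ^ 2.
Proof.
move=> l_gt1 le_ln Hpi; pose k := Nat.sqrt n; pose b := n %/ k.+1.
have l_gt0 := ltnW l_gt1.
have le_lk : l ^ 8 <= k.
  apply/leP/PeanoNat.Nat.sqrt_le_square/leP; rewrite multE.
  by rewrite (_ : _ * _ = l ^ 16) // -expnD.
have le_kn : k * k <= n by apply/leP/PeanoNat.Nat.sqrt_le_square/leP.
have k_gt0 : 0 < k by apply: leq_trans le_lk; rewrite expn_gt0 l_gt0.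
(* From [(k - 1) * (k + 1) < k * k <= n] one gets [k - 1 <= b], and [l ^ 7 < l ^ 8 <= k]. *)
have le_lb : l ^ 7 <= b.
  apply: leq_trans (_ : k.-1 <= _); last first.
    rewrite leq_divRL //; apply: leq_trans le_kn; nia.
  rewrite -ltnS prednK //; apply: leq_trans le_lk.
  by rewrite ltn_exp2l.
have b_gt0 : 0 < b by apply: leq_trans le_lb; rewrite expn_gt0 l_gt0.
have n_gt0 : 0 < n by apply: leq_trans le_ln; rewrite expn_gt0 l_gt0.
have le_2lk : 2 * l ^ 2 <= k.
  apply: leq_trans le_lk; apply: leq_trans (_ : l * l ^ 2 <= _).
    by rewrite leq_mul2r l_gt1 orbT.
  by rewrite -expnS leq_pexp2l.
have Kbn : k.+1 * b <= n by rewrite mulnC leq_trunc_div.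
have [U [g [gU pg ng szU]]] := separator_of_proof Kbn k_gt0 n_gt0 Hpi.
have := monotone_lower_bound l_gt1 l_gt1 b_gt0 k_gt0 le_2lk gU pg ng.
have l_pow m : 0 < l ^ m by rewrite expn_gt0 l_gt0.
(* With [p = l] the loss [M ^ 2] is [l ^ (4 * l)]. The exponents 7 and 8 make [b ^ l.+1] and [k ^ l]
   exceed it, in the second case together with the factor [(l ^ 2) ^ l], by at least [l ^ l]. *)
have E : ((l * l) ^ l) ^ 2 = l ^ (4 * l).
  by rewrite mulnn -!expnM; congr (_ ^ _); ring.
cbv zeta; rewrite E => bound.
suff le_lU : l ^ l <= 2 * size U.
  apply: leq_trans (_ : l ^ l <= _); first by rewrite leq_exp2r.
  apply: leq_trans (leq_trans le_lU (leq_mul (leqnn 2) szU)) _.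
  by rewrite !mulnA.
case: bound => bound.
- have : l ^ (7 * l.+1) <= size U * l ^ (4 * l).
    by apply: leq_trans bound; rewrite expnM leq_exp2r.
  rewrite (_ : 7 * l.+1 = (3 * l + 7) + 4 * l); last by ring.
  rewrite expnD leq_pmul2r // => le_U; apply: leq_trans (leq_pexp2l l_gt0 _) (_ : l ^ (3 * l + 7) <= _); first by lia.
  by apply: leq_trans le_U _; rewrite leq_pmull.
- have : l ^ (8 * l) <= 2 * (size U * l ^ (4 * l)) * (l ^ 2) ^ l.
    by apply: leq_trans bound; rewrite expnM leq_exp2r.
  rewrite -expnM -!mulnA -expnD mulnA (_ : 8 * l = 2 * l + (4 * l + 2 * l)); last by ring.
  rewrite expnD leq_pmul2r // => le_U; apply: leq_trans le_U.
  by apply: leq_pexp2l; lia.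
Qed.

(** For the least [r] with [n <= r ^ 32], the value [l = r.-1 ^ 2] is admissible, because
    [l ^ 16 = r.-1 ^ 32 < n]. Being quadratic in [r], it outweighs the cube of [2 ^ r] and the
    factor [n ^ 2]. *)
Lemma lines_exponential : exists N, forall n, N <= n -> forall pi,
  bpc_proof (Theta_sequent n) pi -> exists2 r, n <= r ^ 32 & 2 ^ r <= size pi.
Proof.
(* With [q = r.-1], the final comparison is [8 + 67 * q.+1 <= 69 * q <= q * q], valid from [q = 69]
   on. The constant is kept abstract so that [69 ^ 32] is never computed. *)
have [c Ec] : exists c, c = 69 by exists 69.
exists (c ^ 32).+1 => n lt_cn pi Hpi.
have n_gt0 : 0 < n by apply: leq_ltn_trans lt_cn.
have ex_r : exists r, n <= r ^ 32 by exists n; rewrite -[leqLHS]expn1 leq_pexp2l.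
case: (ex_minnP ex_r) => r le_nr min_r; exists r => //.
have lt_cr : c < r by rewrite -(ltn_exp2r _ _ (e := 32)) // (leq_trans lt_cn).
have lt_rn : r.-1 ^ 32 < n.
  by rewrite ltnNge; apply/negP=> /min_r; rewrite leqNgt prednK ?leqnn // (leq_ltn_trans _ lt_cr).
rewrite leqNgt; apply/negP=> lt_pi.
have l_gt1 : 1 < r.-1 ^ 2 by rewrite -[1]/(1 ^ 2) ltn_sqr; lia.
have := lines_lower_bound l_gt1 _ Hpi; rewrite -expnM => /(_ (ltnW lt_rn)).
apply/negP; rewrite -ltnNge.
have le_n : n <= 2 ^ (32 * r).
  apply: leq_trans le_nr _; rewrite mulnC expnM leq_exp2r //.
  exact/ltnW/ltn_expl.
apply: leq_ltn_trans (_ : 132 * 2 ^ (3 * r) * 2 ^ (64 * r) < _).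
  rewrite !leq_mul //.
    by rewrite mulnC expnM leq_exp2r // ltnW.
  by rewrite -[64]/(32 * 2) -mulnA mulnCA mulnC expnM leq_exp2r.
apply: leq_trans (_ : 2 ^ (8 + 3 * r + 64 * r) <= _).
  by rewrite (expnD 2 (8 + 3 * r)) (expnD 2 8) !ltn_pmul2r ?expn_gt0.
rewrite leq_exp2l // -mulnn.
move: lt_cr; rewrite Ec; clear; case: r => // q; rewrite ltnS => le_q.
apply: leq_trans (_ : 69 * q <= _); last by rewrite leq_mul2r le_q orbT.
lia.
Qed.

Import Order.TTheory GRing.Theory Num.Theory.
Local Open Scope ring_scope.

Theorem corollary6p9 (R : realType) :
  (forall n : nat, (1 <= n)%N -> bpc_provable (Theta_sequent n)) /\
  (exists eps : R, 0 < eps /\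
     exists N : nat, forall n : nat, (N <= n)%N ->
       forall pi : seq (sequent var), bpc_proof (Theta_sequent n) pi ->
         2 `^ (n%:R `^ eps) <= (size pi)%:R).
Proof.
split=> [n _|]; first exact: Theta_provable.
exists 32%:R^-1; split; first by rewrite invr_gt0 ltr0n.
have [N HN] := lines_exponential; exists N => n leN pi Hpi.
have [r le_nr le_r] := HN n leN pi Hpi.
apply: le_trans (_ : 2 `^ r%:R <= _); last first.
  by rewrite powR_mulrn ?ler0n // -natrX ler_nat.
apply: ler_powR; first by rewrite ler1n.
apply: le_trans (_ : (r ^ 32)%N%:R `^ 32%:R^-1 <= _).
  by rewrite ge0_ler_powR ?nnegrE ?ler0n ?invr_ge0 // ler_nat.
by rewrite natrX -powR_mulrn ?ler0n // -powRrM mulfV ?powRr1 ?ler0n // pnatr_eq0.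
Qed.
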